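(* $\mathrm{FinCorel}$ is the prop for extraspecial commutative Frobenius monoids. That is, the prop presented by generators $m\colon 2\to 1$, $i\colon 0\to 1$, $d\colon 1\to 2$, $e\colon 1\to 0$ subject to the laws of an extraspecial commutative Frobenius monoid is isomorphic to $\mathrm{FinCorel}$, the generators corresponding to the unique corelations $2\to 1$, $0\to 1$, $1\to 2$, $1\to 0$ that have exactly one part.
   Context: A prop is a strict symmetric monoidal category whose objects are the natural numbers, with tensor product of objects given by addition; a morphism of props is a strict symmetric monoidal functor that is the identity on objects. A corelation from a finite set $X$ to a finite set $Y$ is a partition of the disjoint union $X+Y$; equivalently, an isomorphism class of cospans $X\xrightarrow{f} N\xleftarrow{g} Y$ of finite sets that are jointly epic ($f(X)\cup g(Y)=N$). Corelations are composed by forming the pushout of the cospans over the common foot and then restricting its apex to the joint image of the outer feet; equivalently, gluing partitions along the middle set, two elements of the outer sets being in the same part iff there is a path between them. $\mathrm{FinCorel}$ denotes the prop whose morphisms $m\to n$ are the corelations from an $m$-element set to an $n$-element set, with disjoint union as tensor product and the evident braiding. In a symmetric monoidal category with braiding $B$ and unit object $I$, a Frobenius monoid $(X,\mu,\iota,\delta,\epsilon)$ is a monoid $(X,\mu,\iota)$ and a comonoid $(X,\delta,\epsilon)$ with $(\mathrm{id}_X\otimes\mu)(\delta\otimes \mathrm{id}_X)=\delta\mu=(\mu\otimes \mathrm{id}_X)(\mathrm{id}_X\otimes\delta)$. It is commutative if $\mu B=\mu$, special if $\mu\delta=\mathrm{id}_X$, extra if $\epsilon\iota=\mathrm{id}_I$,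 and extraspecial if it is both extra and special. A signature is a functor $\mathbb{N}\times\mathbb{N}\to\mathrm{Set}$ ($\mathbb N\times\mathbb N$ discrete); $F(\Sigma)$ is the free prop on a signature $\Sigma$. The prop presented by generators $\Sigma$ and equations is the coequalizer, in the category of props, of the two morphisms $F(E)\rightrightarrows F(\Sigma)$ sending each equation to its two sides. *)

(* Defs.v *)
From HB Require Import structures.
From mathcomp Require Import all_boot.
From mathcomp Require Import boolp.

Set Implicit Arguments.
Unset Strict Implicit.
Unset Printing Implicit Defensive.

Declare Scope prop_scope.
Delimit Scope prop_scope with P.
Local Open Scope nat_scope.
Local Open Scope quotient_scope.

Record propData := PropData {
  hom :> nat -> nat -> Type;
  pid : forall n, hom n n;
  pcomp : forall m n p, hom n p -> hom m n -> hom m p;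
  ptens : forall m n m' n', hom m n -> hom m' n' -> hom (m + m') (n + n');
  pbraid : forall m n, hom (m + n) (n + m) }.

Arguments pid {_} n.
Arguments pbraid {_} m n.
Notation "g ∘ f" := (pcomp g f) (at level 40, left associativity) : prop_scope.
Notation "f ⊗ g" := (ptens f g) (at level 38, left associativity) : prop_scope.
Local Open Scope prop_scope.

(* The tensor of objects is strictly associative and unital only up to a
   propositional equality of natural numbers. *)
Definition cast_hom (D : propData) m m' n n' (em : m = m') (en : n = n')
    (f : D m n) : D m' n' :=
  ecast k (D m' k) en (ecast k (D k n) em f).

(* The pairs of parallel morphisms which the axioms of a strict symmetric
   monoidal category identify.  They are given as a relation, rather than as
   equations, because the free prop is the quotient of a structure in which
   they fail.  The compatibility of the braiding with the unit object follows
   from [law_braid_hex] and [law_braidK]. *)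
Inductive prop_law (D : propData) : forall m n, D m n -> D m n -> Prop :=
| law_comp_idl m n (f : D m n) : prop_law (pid n ∘ f) f
| law_comp_idr m n (f : D m n) : prop_law (f ∘ pid m) f
| law_compA m n p q (f : D m n) (g : D n p) (h : D p q) :
    prop_law (h ∘ (g ∘ f)) ((h ∘ g) ∘ f)
| law_tens_id m n : prop_law (@pid D m ⊗ @pid D n) (pid (m + n))
| law_tens_comp m n p m' n' p'
    (f : D m n) (g : D n p) (f' : D m' n') (g' : D n' p') :
    prop_law ((g ∘ f) ⊗ (g' ∘ f')) ((g ⊗ g') ∘ (f ⊗ f'))
| law_tensA m n m' n' m'' n'' (f : D m n) (g : D m' n') (h : D m'' n'') :
    prop_law (cast_hom (addnA m m' m'') (addnA n n' n'') (f ⊗ (g ⊗ h)))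
             ((f ⊗ g) ⊗ h)
| law_tens_unitl m n (f : D m n) :
    prop_law (cast_hom (add0n m) (add0n n) (pid 0 ⊗ f)) f
| law_tens_unitr m n (f : D m n) :
    prop_law (cast_hom (addn0 m) (addn0 n) (f ⊗ pid 0)) f
| law_braid_nat m n m' n' (f : D m n) (f' : D m' n') :
    prop_law (pbraid n n' ∘ (f ⊗ f')) ((f' ⊗ f) ∘ pbraid m m')
| law_braidK m n : prop_law (@pbraid D n m ∘ pbraid m n) (pid (m + n))
| law_braid_hex m n p :
    prop_law (cast_hom (addnA m n p) (esym (addnA n p m)) (@pbraid D m (n + p)))
             (cast_hom (addnA n m p) (erefl _) (pid n ⊗ pbraid m p)
              ∘ (pbraid m n ⊗ pid p)).

Definition isProp (D : propData) : Prop :=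
  forall m n (f g : D m n), prop_law f g -> f = g.

Record prop := Prop_ { propDataOf :> propData; propP : isProp propDataOf }.

Record propMor (P Q : propData) := PropMor {
  mor : forall m n, P m n -> Q m n;
  mor_id : forall n, mor (pid n) = pid n;
  mor_comp : forall m n p (g : P n p) (f : P m n),
    mor (g ∘ f) = mor g ∘ mor f;
  mor_tens : forall m n m' n' (f : P m n) (g : P m' n'),
    mor (f ⊗ g) = mor f ⊗ mor g;
  mor_braid : forall m n, mor (pbraid m n) = pbraid m n }.
Arguments mor {P Q} _ {m n} _.

Definition isPropIso (P Q : propData) (phi : propMor P Q) : Prop :=
  exists psi : propMor Q P,
    (forall m n (f : P m n), mor psi (mor phi f) = f) /\
    (forall m n (g : Q m n), mor phi (mor psi g) = g).

Lemma mor_cast (P Q : propData) (phi : propMor P Q) m m' n n'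
    (em : m = m') (en : n = n') (f : P m n) :
  mor phi (cast_hom em en f) = cast_hom em en (mor phi f).
Proof. by case: m' / em; case: n' / en. Qed.

Definition propMor_comp (P Q R : propData)
    (psi : propMor Q R) (phi : propMor P Q) : propMor P R.
Proof.
exists (fun m n f => mor psi (mor phi f)).
- by move=> n; rewrite !mor_id.
- by move=> m n p g f; rewrite !mor_comp.
- by move=> m n m' n' f g; rewrite !mor_tens.
- by move=> m n; rewrite !mor_braid.
Defined.

Inductive gen_congr (D : propData)
    (R : forall m n, D m n -> D m n -> Prop) :
    forall m n, D m n -> D m n -> Prop :=
| gc_base m n (f g : D m n) : R m n f g -> gen_congr R f g
| gc_refl m n (f : D m n) : gen_congr R f f
| gc_sym m n (f g : D m n) : gen_congr R f g -> gen_congr R g f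
| gc_trans m n (f g h : D m n) :
    gen_congr R f g -> gen_congr R g h -> gen_congr R f h
| gc_comp m n p (g g' : D n p) (f f' : D m n) :
    gen_congr R g g' -> gen_congr R f f' -> gen_congr R (g ∘ f) (g' ∘ f')
| gc_tens m n m' n' (f f' : D m n) (g g' : D m' n') :
    gen_congr R f f' -> gen_congr R g g' -> gen_congr R (f ⊗ g) (f' ⊗ g').

Definition quot_rel (D : propData) (R : forall m n, D m n -> D m n -> Prop)
    m n : rel {classic D m n} := fun f g => `[< gen_congr R f g >].

Lemma quot_rel_refl (D : propData)
    (R : forall m n, D m n -> D m n -> Prop) m n : reflexive (@quot_rel D R m n).
Proof. by move=> f; apply/asboolP/gc_refl. Qed.

Lemma quot_rel_sym (D : propData)
    (R : forall m n, D m n -> D m n -> Prop) m n : symmetric (@quot_rel D R m n).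
Proof. by move=> f g; apply/asboolP/asboolP => /gc_sym. Qed.

Lemma quot_rel_trans (D : propData)
    (R : forall m n, D m n -> D m n -> Prop) m n : transitive (@quot_rel D R m n).
Proof.
move=> g f h /asboolP fg /asboolP gh; apply/asboolP; exact: gc_trans fg gh.
Qed.

Definition quot_equiv (D : propData)
    (R : forall m n, D m n -> D m n -> Prop) m n : equiv_rel {classic D m n} :=
  EquivRel (@quot_rel D R m n) (@quot_rel_refl D R m n)
    (@quot_rel_sym D R m n) (@quot_rel_trans D R m n).

Definition quot_hom (D : propData)
    (R : forall m n, D m n -> D m n -> Prop) m n : Type := {eq_quot (@quot_equiv D R m n)}.

Definition qpi (D : propData)
    (R : forall m n, D m n -> D m n -> Prop) m n (f : D m n) : quot_hom R m n :=
  \pi_({eq_quot (@quot_equiv D R m n)}) f.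

Definition qrepr (D : propData)
    (R : forall m n, D m n -> D m n -> Prop) m n (q : @quot_hom D R m n) : D m n :=
  @repr {classic D m n} {eq_quot (@quot_equiv D R m n)} q.

Lemma qreprK (D : propData)
    (R : forall m n, D m n -> D m n -> Prop) m n (q : @quot_hom D R m n) : qpi R (qrepr q) = q.
Proof. exact: reprK. Qed.

Lemma qpiP (D : propData)
    (R : forall m n, D m n -> D m n -> Prop) m n (f g : D m n) :
  qpi R f = qpi R g <-> gen_congr R f g.
Proof.
split=> [e|fg]; first by apply/asboolP; apply/(@eqmodP _ (quot_equiv R m n)).
by apply/(@eqmodP _ (quot_equiv R m n))/asboolP.
Qed.

Lemma qrepr_pi (D : propData)
    (R : forall m n, D m n -> D m n -> Prop) m n (f : D m n) :
  gen_congr R (qrepr (qpi R f)) f.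
Proof. by apply/qpiP; rewrite qreprK. Qed.

Definition quotData (D : propData)
    (R : forall m n, D m n -> D m n -> Prop) : propData := {|
  hom := @quot_hom D R;
  pid n := qpi R (pid n);
  pcomp m n p g f := qpi R (qrepr g ∘ qrepr f);
  ptens m n m' n' f g := qpi R (qrepr f ⊗ qrepr g);
  pbraid m n := qpi R (pbraid m n) |}.

Definition quot_mor (D : propData)
    (R : forall m n, D m n -> D m n -> Prop) : propMor D (@quotData D R).
Proof.
exists (fun m n (f : D m n) => qpi R f) => //.
- by move=> m n p g f; apply/qpiP/gc_comp; apply/gc_sym/qrepr_pi.
- by move=> m n m' n' f g; apply/qpiP/gc_tens; apply/gc_sym/qrepr_pi.
Defined.

Lemma quot_mor_surj (D : propData)
    (R : forall m n, D m n -> D m n -> Prop) m n (q : @quotData D R m n) :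
  exists f, q = mor (quot_mor R) f.
Proof. by exists (qrepr q); rewrite -[LHS]qreprK. Qed.

Lemma prop_law_lift (D : propData)
    (R : forall m n, D m n -> D m n -> Prop) m n (q r : @quotData D R m n) :
  prop_law q r -> exists f g : D m n,
    [/\ prop_law f g, q = mor (quot_mor R) f & r = mor (quot_mor R) g].
Proof.
have sj := @quot_mor_surj D R.
case=> {m n q r}.
- move=> m n q; have [f ->] := sj _ _ q.
  by exists (pid n ∘ f), f; rewrite mor_comp mor_id; split=> //; constructor.
- move=> m n q; have [f ->] := sj _ _ q.
  by exists (f ∘ pid m), f; rewrite mor_comp mor_id; split=> //; constructor.
- move=> m n p q a b c.
  have [f ->] := sj _ _ a; have [g ->] := sj _ _ b; have [h ->] := sj _ _ c.
  exists (h ∘ (g ∘ f)), ((h ∘ g) ∘ f).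
  by rewrite !mor_comp; split=> //; constructor.
- move=> m n; exists (pid m ⊗ pid n), (pid (m + n)).
  by rewrite mor_tens !mor_id; split=> //; constructor.
- move=> m n p m' n' p' a b a' b'.
  have [f ->] := sj _ _ a; have [g ->] := sj _ _ b.
  have [f' ->] := sj _ _ a'; have [g' ->] := sj _ _ b'.
  exists ((g ∘ f) ⊗ (g' ∘ f')), ((g ⊗ g') ∘ (f ⊗ f')).
  by rewrite !(mor_tens, mor_comp); split=> //; constructor.
- move=> m n m' n' m'' n'' a b c.
  have [f ->] := sj _ _ a; have [g ->] := sj _ _ b; have [h ->] := sj _ _ c.
  exists (cast_hom (addnA m m' m'') (addnA n n' n'') (f ⊗ (g ⊗ h))),
    ((f ⊗ g) ⊗ h).
  by rewrite mor_cast !mor_tens; split=> //; constructor.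
- move=> m n q; have [f ->] := sj _ _ q.
  exists (cast_hom (add0n m) (add0n n) (pid 0 ⊗ f)), f.
  by rewrite mor_cast mor_tens mor_id; split=> //; constructor.
- move=> m n q; have [f ->] := sj _ _ q.
  exists (cast_hom (addn0 m) (addn0 n) (f ⊗ pid 0)), f.
  by rewrite mor_cast mor_tens mor_id; split=> //; constructor.
- move=> m n m' n' a b.
  have [f ->] := sj _ _ a; have [f' ->] := sj _ _ b.
  exists (pbraid n n' ∘ (f ⊗ f')), ((f' ⊗ f) ∘ pbraid m m').
  by rewrite !(mor_comp, mor_tens, mor_braid); split=> //; constructor.
- move=> m n; exists (pbraid n m ∘ pbraid m n), (pid (m + n)).
  by rewrite mor_comp mor_id !mor_braid; split=> //; constructor.
- move=> m n p.
  exists (cast_hom (addnA m n p) (esym (addnA n p m)) (pbraid m (n + p))),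
    (cast_hom (addnA n m p) (erefl _) (pid n ⊗ pbraid m p)
     ∘ (pbraid m n ⊗ pid p)).
  rewrite mor_comp !mor_cast !mor_tens !mor_id !mor_braid.
  by split=> //; constructor.
Qed.

Lemma quot_isProp (D : propData) (R : forall m n, D m n -> D m n -> Prop) :
  (forall m n (f g : D m n), prop_law f g -> gen_congr R f g) ->
  isProp (quotData R).
Proof.
move=> DR m n q r /prop_law_lift[f [g [/DR fg -> ->]]].
exact/qpiP.
Qed.

Lemma gen_congr_mor (D : propData) (R : forall m n, D m n -> D m n -> Prop)
    (P : propData) (phi : propMor D P) :
  (forall m n (f g : D m n), R m n f g -> mor phi f = mor phi g) ->
  forall m n (f g : D m n), gen_congr R f g -> mor phi f = mor phi g.
Proof.
move=> Rphi m n f g; elim=> {m n f g} //.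
- by move=> m n f g h _ -> _ ->.
- by move=> m n p g g' f f' _ eg _ ef; rewrite !mor_comp eg ef.
- by move=> m n m' n' f f' g g' _ ef _ eg; rewrite !mor_tens eg ef.
Qed.

Lemma gen_congr_mor_repr (D : propData)
    (R : forall m n, D m n -> D m n -> Prop) (P : propData)
    (phi : propMor D P)
    (Rphi : forall m n (f g : D m n), R m n f g -> mor phi f = mor phi g)
    m n (f : D m n) :
  mor phi (qrepr (qpi R f)) = mor phi f.
Proof. exact: (gen_congr_mor Rphi (qrepr_pi R f)). Qed.

Definition quot_lift (D : propData) (R : forall m n, D m n -> D m n -> Prop)
    (P : propData) (phi : propMor D P)
    (Rphi : forall m n (f g : D m n), R m n f g -> mor phi f = mor phi g) :
  propMor (quotData R) P.
Proof.
exists (fun m n (q : quotData R m n) => mor phi (qrepr q)).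
- by move=> n; rewrite (gen_congr_mor_repr Rphi) mor_id.
- by move=> m n p g f; rewrite (gen_congr_mor_repr Rphi) mor_comp.
- by move=> m n m' n' f g; rewrite (gen_congr_mor_repr Rphi) mor_tens.
- by move=> m n; rewrite (gen_congr_mor_repr Rphi) mor_braid.
Defined.

Lemma quot_liftE (D : propData) (R : forall m n, D m n -> D m n -> Prop)
    (P : propData) (phi : propMor D P)
    (Rphi : forall m n (f g : D m n), R m n f g -> mor phi f = mor phi g)
    m n (f : D m n) :
  mor (quot_lift Rphi) (mor (quot_mor R) f) = mor phi f.
Proof. exact: gen_congr_mor_repr. Qed.

(* A functor from the discrete category on pairs of naturals to types. *)
Definition signature := nat -> nat -> Type.

Inductive term (S : signature) : nat -> nat -> Type :=
| t_gen m n of S m n : term S m n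
| t_id n : term S n n
| t_comp m n p of term S n p & term S m n : term S m p
| t_tens m n m' n' of term S m n & term S m' n' : term S (m + m') (n + n')
| t_braid m n : term S (m + n) (n + m).

Definition termData (S : signature) : propData := {|
  hom := term S;
  pid := @t_id S;
  pcomp := @t_comp S;
  ptens := @t_tens S;
  pbraid := @t_braid S |}.

(* [free_liftE] and [free_lift_uniq] below are its universal property. *)
Definition freeProp (S : signature) : prop :=
  Prop_ (quot_isProp (R := @prop_law (termData S)) (@gc_base _ _)).

Definition free_gen (S : signature) m n (s : S m n) : freeProp S m n :=
  mor (quot_mor (@prop_law (termData S))) (t_gen s : termData S m n).

Fixpoint term_eval (S : signature) (P : propData)
    (h : forall m n, S m n -> P m n) m n (t : term S m n) : P m n :=
  match t with
  | t_gen _ _ s => h _ _ s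
  | t_id n => pid n
  | t_comp _ _ _ u v => term_eval h u ∘ term_eval h v
  | t_tens _ _ _ _ u v => term_eval h u ⊗ term_eval h v
  | t_braid m n => pbraid m n
  end.

Definition term_mor (S : signature) (P : propData)
    (h : forall m n, S m n -> P m n) : propMor (termData S) P :=
  @PropMor (termData S) P (@term_eval S P h) (fun _ => erefl)
    (fun _ _ _ _ _ => erefl) (fun _ _ _ _ _ _ => erefl) (fun _ _ => erefl).

Lemma mor_prop_law (D P : propData) (phi : propMor D P) m n (f g : D m n) :
  prop_law f g -> prop_law (mor phi f) (mor phi g).
Proof.
case=> {m n f g}; intros;
by rewrite ?(mor_cast, mor_comp, mor_tens, mor_id, mor_braid); constructor.
Qed.

Lemma term_mor_law (S : signature) (P : prop)
    (h : forall m n, S m n -> P m n) m n (f g : termData S m n) :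
  prop_law f g -> mor (term_mor h) f = mor (term_mor h) g.
Proof. by move=> fg; apply: propP; apply: mor_prop_law. Qed.

Definition free_lift (S : signature) (P : prop)
    (h : forall m n, S m n -> P m n) : propMor (freeProp S) P :=
  quot_lift (term_mor_law h).

Lemma free_liftE (S : signature) (P : prop) (h : forall m n, S m n -> P m n)
    m n (s : S m n) :
  mor (free_lift h) (free_gen s) = h m n s.
Proof. exact: (quot_liftE (term_mor_law h) (t_gen s : termData S m n)). Qed.

Lemma free_lift_uniq (S : signature) (P : prop) (h : forall m n, S m n -> P m n)
    (phi : propMor (freeProp S) P) :
  (forall m n (s : S m n), mor phi (free_gen s) = h m n s) ->
  forall m n (f : freeProp S m n), mor phi f = mor (free_lift h) f.
Proof.
move=> phiE m n q; have [t ->] := quot_mor_surj q.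
have tE : mor (propMor_comp (free_lift h) (quot_mor _)) t
        = mor (propMor_comp phi (quot_mor _)) t.
  elim: t {q} => {m n}.
  - by move=> m n s; rewrite [RHS]phiE [LHS]free_liftE.
  - by move=> n; rewrite [LHS](mor_id _ n) [RHS](mor_id _ n).
  - move=> m n p u IHu v IHv.
    have tc chi : mor chi (t_comp u v : termData S m p)
        = mor chi (u : termData S n p) ∘ mor chi (v : termData S m n) :> P _ _.
      exact: mor_comp.
    by rewrite !tc IHu IHv.
  - move=> m n m' n' u IHu v IHv.
    have tt chi : mor chi (t_tens u v : termData S (m + m') (n + n'))
        = mor chi (u : termData S m n) ⊗ mor chi (v : termData S m' n')
        :> P _ _.
      exact: mor_tens.
    by rewrite !tt IHu IHv.
  - by move=> m n; rewrite [LHS](mor_braid _ m n) [RHS](mor_braid _ m n).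
exact: esym tE.
Qed.

Inductive coeq_rel (P Q : propData) (phi psi : propMor P Q) :
    forall m n, Q m n -> Q m n -> Prop :=
| CoeqRel m n (f : P m n) : coeq_rel phi psi (mor phi f) (mor psi f).

Lemma coeq_isProp (P Q : prop) (phi psi : propMor P Q) :
  isProp (quotData (@coeq_rel P Q phi psi)).
Proof. by apply: quot_isProp => m n f g /propP ->; apply: gc_refl. Qed.

(* [coeq_morE] and [coeq_univ] below are its universal property. *)
Definition coeq (P Q : prop) (phi psi : propMor P Q) : prop :=
  Prop_ (@coeq_isProp P Q phi psi).

Definition coeq_mor (P Q : prop) (phi psi : propMor P Q) :
  propMor Q (coeq phi psi) := quot_mor (@coeq_rel P Q phi psi).

Lemma coeq_morE (P Q : prop) (phi psi : propMor P Q) m n (f : P m n) :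
  mor (coeq_mor phi psi) (mor phi f) = mor (coeq_mor phi psi) (mor psi f).
Proof. by apply/qpiP/gc_base. Qed.

Lemma coeq_univ (P Q R : prop) (phi psi : propMor P Q) (chi : propMor Q R) :
  (forall m n (f : P m n), mor chi (mor phi f) = mor chi (mor psi f)) ->
  exists u : propMor (coeq phi psi) R,
    (forall m n (g : Q m n), mor u (mor (coeq_mor phi psi) g) = mor chi g) /\
    (forall v : propMor (coeq phi psi) R,
      (forall m n (g : Q m n), mor v (mor (coeq_mor phi psi) g) = mor chi g) ->
      forall m n (q : coeq phi psi m n), mor v q = mor u q).
Proof.
move=> chiE.
have relE m n (f g : Q m n) : coeq_rel phi psi f g -> mor chi f = mor chi g.
  by case=> *; apply: chiE.
exists (quot_lift relE); split=> [m n g|v vE m n q]; first exact: quot_liftE.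
have [g ->] := quot_mor_surj q.
by rewrite [LHS]vE quot_liftE.
Qed.

Definition presented (S E : signature)
    (lhs rhs : forall m n, E m n -> freeProp S m n) : prop :=
  coeq (free_lift lhs) (free_lift rhs).

Definition presented_gen (S E : signature)
    (lhs rhs : forall m n, E m n -> freeProp S m n) m n (s : S m n) :
    presented lhs rhs m n :=
  mor (coeq_mor (free_lift lhs) (free_lift rhs)) (free_gen s).

Inductive frob_gen : signature :=
| g_mul : frob_gen 2 1
| g_unit : frob_gen 0 1
| g_comul : frob_gen 1 2
| g_counit : frob_gen 1 0.

Inductive frob_eqn : signature :=
| e_assoc : frob_eqn 3 1
| e_unitl : frob_eqn 1 1
| e_unitr : frob_eqn 1 1
| e_coassoc : frob_eqn 1 3
| e_counitl : frob_eqn 1 1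
| e_counitr : frob_eqn 1 1
| e_frobl : frob_eqn 2 2
| e_frobr : frob_eqn 2 2
| e_comm : frob_eqn 2 1
| e_special : frob_eqn 1 1
| e_extra : frob_eqn 0 0.

Definition frob_sides (P : propData)
    (mu : P 2 1) (iota : P 0 1) (delta : P 1 2) (epsilon : P 1 0)
    m n (e : frob_eqn m n) : P m n * P m n :=
  match e in frob_eqn m n return (P m n * P m n)%type with
  | e_assoc => (mu ∘ (mu ⊗ pid 1), mu ∘ (pid 1 ⊗ mu))
  | e_unitl => (mu ∘ (iota ⊗ pid 1), pid 1)
  | e_unitr => (mu ∘ (pid 1 ⊗ iota), pid 1)
  | e_coassoc => ((delta ⊗ pid 1) ∘ delta, (pid 1 ⊗ delta) ∘ delta)
  | e_counitl => ((epsilon ⊗ pid 1) ∘ delta, pid 1)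
  | e_counitr => ((pid 1 ⊗ epsilon) ∘ delta, pid 1)
  | e_frobl => ((pid 1 ⊗ mu) ∘ (delta ⊗ pid 1), delta ∘ mu)
  | e_frobr => (delta ∘ mu, (mu ⊗ pid 1) ∘ (pid 1 ⊗ delta))
  | e_comm => (mu ∘ pbraid 1 1, mu)
  | e_special => (mu ∘ delta, pid 1)
  | e_extra => (epsilon ∘ iota, pid 0)
  end.

Definition frob_free_sides m n (e : frob_eqn m n) :
    freeProp frob_gen m n * freeProp frob_gen m n :=
  frob_sides (free_gen g_mul) (free_gen g_unit)
             (free_gen g_comul) (free_gen g_counit) e.

Definition frob_lhs m n (e : frob_eqn m n) := (frob_free_sides e).1.
Definition frob_rhs m n (e : frob_eqn m n) := (frob_free_sides e).2.

Definition FrobProp : prop := presented frob_lhs frob_rhs.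

Definition frobProp_gen m n (s : frob_gen m n) : FrobProp m n :=
  presented_gen frob_lhs frob_rhs s.

Record corel (m n : nat) := Corel {
  parts : {set {set 'I_m + 'I_n}};
  partsP : partition parts [set: 'I_m + 'I_n] }.

HB.instance Definition _ m n := [isSub for @parts m n].

Definition same_part m n (c : corel m n) : rel ('I_m + 'I_n) :=
  fun x y => y \in pblock (parts c) x.

Definition corel_of_equiv m n (r : rel ('I_m + 'I_n)) (er : equivalence_rel r) :
    corel m n :=
  Corel (equivalence_partitionP
    (in3W er : {in [set: 'I_m + 'I_n] & &, equivalence_rel r})).

Lemma same_part_of_equiv m n (r : rel ('I_m + 'I_n)) (er : equivalence_rel r) :
  same_part (corel_of_equiv er) =2 r.
Proof.
by move=> x y; apply: pblock_equivalence_partition; rewrite ?inE.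
Qed.

Lemma same_part_equiv m n (c : corel m n) : equivalence_rel (same_part c).
Proof.
have /and3P[/eqP cov tr _] := partsP c.
move=> x y z; rewrite /same_part mem_pblock cov inE; split=> // xy.
by rewrite (same_pblock tr xy).
Qed.

Lemma corel_ext m n (c d : corel m n) : same_part c =2 same_part d -> c = d.
Proof.
move=> cd; apply: val_inj => /=.
rewrite -(equivalence_partition_pblock (partsP c)).
rewrite -(equivalence_partition_pblock (partsP d)).
apply: eq_imset => x; apply/setP => y; rewrite !inE /=; exact: cd.
Qed.

Definition cospan_map (N : Type) m n (f : 'I_m -> N) (g : 'I_n -> N)
    (x : 'I_m + 'I_n) : N :=
  match x with inl i => f i | inr j => g j end.

Lemma cospan_equiv (N : eqType) m n (f : 'I_m -> N) (g : 'I_n -> N) :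
  equivalence_rel (fun x y => cospan_map f g x == cospan_map f g y).
Proof. by move=> x y z; rewrite eqxx; split=> // /eqP ->. Qed.

(* The kernel of the copairing; [f] and [g] need not be jointly epic, as the
   kernel ignores the rest of the apex. *)
Definition corel_of_cospan (N : eqType) m n (f : 'I_m -> N) (g : 'I_n -> N) :
    corel m n :=
  corel_of_equiv (cospan_equiv f g).

Definition corel_id n : corel n n := corel_of_cospan (@id 'I_n) (@id 'I_n).

Definition braid_leg m n (k : 'I_(n + m)) : 'I_(m + n) :=
  match split k with inl j => rshift m j | inr i => lshift n i end.

Definition corel_braid m n : corel (m + n) (n + m) :=
  corel_of_cospan (@id 'I_(m + n)) (@braid_leg m n).

Definition glue12 m n p (x : 'I_m + 'I_n) : 'I_m + 'I_n + 'I_p := inl x.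
Definition glue23 m n p (x : 'I_n + 'I_p) : 'I_m + 'I_n + 'I_p :=
  match x with inl j => inl (inr j) | inr k => inr k end.
Definition glue13 m n p (x : 'I_m + 'I_p) : 'I_m + 'I_n + 'I_p :=
  match x with inl i => inl (inl i) | inr k => inr k end.

Definition glue_step m n p (d : corel n p) (c : corel m n) :
    rel ('I_m + 'I_n + 'I_p) := fun u v =>
  [exists x, exists y,
     [&& same_part c x y, u == glue12 p x & v == glue12 p y]] ||
  [exists x, exists y,
     [&& same_part d x y, u == glue23 m x & v == glue23 m y]].

Definition glue_rel m n p (d : corel n p) (c : corel m n) :
    rel ('I_m + 'I_p) :=
  fun x y => connect (glue_step d c) (glue13 n x) (glue13 n y).

Lemma same_part_sym m n (c : corel m n) : symmetric (same_part c).
Proof.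
have /equivalence_relP[rx ltr] := @same_part_equiv _ _ c.
by move=> x y; apply/idP/idP => /ltr <-.
Qed.

Lemma glue_step_sym m n p (d : corel n p) (c : corel m n) :
  symmetric (glue_step d c).
Proof.
move=> u v; rewrite /glue_step; congr orb;
apply/existsP/existsP => -[x /existsP[y /and3P[xy ux vy]]];
by exists y; apply/existsP; exists x; rewrite same_part_sym xy ux vy.
Qed.

Lemma glue_rel_equiv m n p (d : corel n p) (c : corel m n) :
  equivalence_rel (glue_rel d c).
Proof.
move=> x y z; rewrite /glue_rel connect0; split=> //.
by move=> xy; apply: same_connect => //; apply/sym_connect_sym/glue_step_sym.
Qed.

(* Two outer points are in the same part iff a path through the middle set
   ['I_n] joins them. *)
Definition corel_comp m n p (d : corel n p) (c : corel m n) : corel m p :=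
  corel_of_equiv (glue_rel_equiv d c).

Definition tens_split m n m' n' (x : 'I_(m + m') + 'I_(n + n')) :
    ('I_m + 'I_n) + ('I_m' + 'I_n') :=
  match x with
  | inl i => match split i with inl a => inl (inl a) | inr b => inr (inl b) end
  | inr j => match split j with inl a => inl (inr a) | inr b => inr (inr b) end
  end.

Definition tens_rel m n m' n' (c : corel m n) (c' : corel m' n') :
    rel ('I_(m + m') + 'I_(n + n')) := fun x y =>
  match tens_split x, tens_split y with
  | inl a, inl b => same_part c a b
  | inr a, inr b => same_part c' a b
  | _, _ => false
  end.

Lemma tens_rel_equiv m n m' n' (c : corel m n) (c' : corel m' n') :
  equivalence_rel (tens_rel c c').
Proof.
move=> x y z; rewrite /tens_rel.
split; first by case: (tens_split z) => a; apply: (same_part_equiv _ a a a).1.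
case: (tens_split x) (tens_split y) (tens_split z) => a [] b [] d //;
  exact: (same_part_equiv _ a b d).2.
Qed.

Definition corel_tens m n m' n' (c : corel m n) (c' : corel m' n') :
    corel (m + m') (n + n') :=
  corel_of_equiv (tens_rel_equiv c c').

Definition corelData : propData := {|
  hom := corel;
  pid := corel_id;
  pcomp := corel_comp;
  ptens := corel_tens;
  pbraid := corel_braid |}.

(* A corelation is determined by the boolean colourings of its feet which are
   constant on its parts, and composition of corelations becomes composition
   of relations between colourings. *)
Definition col m n (c : corel m n) (f : 'I_m -> bool) (g : 'I_n -> bool) :
    Prop :=
  forall x y, same_part c x y -> cospan_map f g x = cospan_map f g y.

Lemma col_ext m n (c d : corel m n) :
  (forall f g, col c f g <-> col d f g) -> c = d.
Proof.
have main (c1 c2 : corel m n) : (forall f g, col c1 f g -> col c2 f g) ->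
    forall x y, same_part c2 x y -> same_part c1 x y.
  move=> c12 x y xy.
  pose f i := same_part c1 x (inl i); pose g j := same_part c1 x (inr j).
  have fgE z : cospan_map f g z = same_part c1 x z by case: z.
  have /c12/(_ x y xy) : col c1 f g.
    move=> z w zw; rewrite !fgE ![same_part c1 x _]same_part_sym.
    exact: (same_part_equiv _ z w x).2.
  by rewrite !fgE => <-; apply: (same_part_equiv _ x x x).1.
move=> cd; apply: corel_ext => x y; apply/idP/idP; apply: main => f g;
  by case: (cd f g).
Qed.

Lemma col_cospan m n (b : 'I_n -> 'I_m) f g :
  col (corel_of_cospan (@id 'I_m) b) f g <-> g = f \o b.
Proof.
split=> [H|-> x y].
  apply: funext => j /=.
  by apply: (H (inr j) (inl (b j))); rewrite same_part_of_equiv /=.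
rewrite same_part_of_equiv => /eqP.
have E z : cospan_map f (f \o b) z = f (cospan_map id b z) by case: z.
by rewrite !E => ->.
Qed.

Lemma col_comp m n p (d : corel n p) (c : corel m n) f h :
  col (corel_comp d c) f h <-> exists g, col c f g /\ col d g h.
Proof.
split=> [H|[g [cfg dgh]] x y].
  pose L u := [exists x, connect (glue_step d c) (glue13 n x) u
                         && cospan_map f h x].
  have L13 x : L (glue13 n x) = cospan_map f h x.
    apply/existsP/idP => [[y /andP[yx]]|]; last by exists x; rewrite connect0.
    by rewrite -(H y x) // same_part_of_equiv.
  have Lstep u v : glue_step d c u v -> L u = L v.
    move=> uv; apply: eq_existsb => x; congr andb; apply/idP/idP => xu.
      exact: connect_trans xu (connect1 uv).
    by apply: connect_trans xu (connect1 _); rewrite glue_step_sym.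
  exists (fun j => L (inl (inr j))); split=> x y xy.
    have E z : cospan_map f (fun j => L (inl (inr j))) z = L (glue12 p z).
      by case: z => [i|//]; exact: esym (L13 (inl i)).
    rewrite !E; apply: Lstep; apply/orP; left.
    by apply/existsP; exists x; apply/existsP; exists y; rewrite xy !eqxx.
  have E z : cospan_map (fun j => L (inl (inr j))) h z = L (glue23 m z).
    by case: z => [//|k]; exact: esym (L13 (inr k)).
  rewrite !E; apply: Lstep; apply/orP; right.
  by apply/existsP; exists x; apply/existsP; exists y; rewrite xy !eqxx.
rewrite same_part_of_equiv => xy.
pose L (u : 'I_m + 'I_n + 'I_p) :=
  match u with inl z => cospan_map f g z | inr k => h k end.
have L13 z : cospan_map f h z = L (glue13 n z) by case: z.
have L23 z : cospan_map g h z = L (glue23 m z) by case: z.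
have cl : closed (glue_step d c) [pred u | L u].
  move=> u v; rewrite !inE => /orP[] /existsP[z /existsP[w]].
    by move=> /and3P[zw /eqP-> /eqP->]; apply: cfg.
  by move=> /and3P[zw /eqP-> /eqP->]; rewrite -!L23; apply: dgh.
by have := closed_connect cl xy; rewrite !inE -!L13.
Qed.

Lemma col_tens m n m' n' (c : corel m n) (c' : corel m' n') f g :
  col (corel_tens c c') f g <->
  col c (f \o @lshift m m') (g \o @lshift n n') /\
  col c' (f \o @rshift m m') (g \o @rshift n n').
Proof.
have E x : cospan_map f g x = match tens_split x with
  | inl a => cospan_map (f \o @lshift m m') (g \o @lshift n n') a
  | inr a => cospan_map (f \o @rshift m m') (g \o @rshift n n') a end.
  by case: x => i; rewrite /= -{1}[i]splitK; case: (split i).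
have sjl (a : 'I_m + 'I_n) :
    exists x, tens_split x = inl a :> ('I_m + 'I_n) + ('I_m' + 'I_n').
  case: a => i; [exists (inl (lshift m' i))|exists (inr (lshift n' i))];
  by rewrite /= (unsplitK (inl i)).
have sjr (a : 'I_m' + 'I_n') :
    exists x, tens_split x = inr a :> ('I_m + 'I_n) + ('I_m' + 'I_n').
  case: a => i; [exists (inl (rshift m i))|exists (inr (rshift n i))];
  by rewrite /= (unsplitK (inr i)).
split=> [H|[H H'] x y].
  split=> a b ab.
    have [x xa] := sjl a; have [y yb] := sjl b.
    have := H x y; rewrite !E same_part_of_equiv /tens_rel xa yb; exact.
  have [x xa] := sjr a; have [y yb] := sjr b.
  have := H x y; rewrite !E same_part_of_equiv /tens_rel xa yb; exact.
rewrite same_part_of_equiv /tens_rel !E.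
by case: (tens_split x) (tens_split y) => a [] b //; [apply: H|apply: H'].
Qed.

Lemma col_cast m m' n n' (em : m = m') (en : n = n') (c : corelData m n) f g :
  col (cast_hom em en c : corel m' n') f g <->
  col (c : corel m n) (f \o cast_ord em) (g \o cast_ord en).
Proof.
case: m' / em f; case: n' / en g => g f /=.
have E k (h : 'I_k -> bool) : h \o cast_ord (erefl k) = h.
  by apply: funext => i; rewrite /= cast_ord_id.
by rewrite !E.
Qed.

Lemma col_id n f g : col (corel_id n) f g <-> g = f.
Proof. exact: col_cospan. Qed.

Lemma col_braid m n f g :
  col (corel_braid m n) f g <-> g = f \o @braid_leg m n.
Proof. exact: col_cospan. Qed.

Lemma ord_split_ext m n (T : Type) (f g : 'I_(m + n) -> T) :
  f \o @lshift m n = g \o @lshift m n -> f \o @rshift m n = g \o @rshift m n ->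
  f = g.
Proof.
move=> fgl fgr; apply: funext => i; rewrite -[i]splitK; case: (split i) => j.
  exact: (congr1 (@^~ j) fgl).
exact: (congr1 (@^~ j) fgr).
Qed.

Lemma braid_leg_lshift m n : @braid_leg m n \o @lshift n m = @rshift m n.
Proof. by apply: funext => j; rewrite /= /braid_leg (unsplitK (inl j)). Qed.

Lemma braid_leg_rshift m n : @braid_leg m n \o @rshift n m = @lshift m n.
Proof. by apply: funext => j; rewrite /= /braid_leg (unsplitK (inr j)). Qed.

Lemma comp_legl m n T (f : 'I_(m + n) -> T) :
  (f \o @braid_leg m n) \o @lshift n m = f \o @rshift m n.
Proof. by rewrite -braid_leg_lshift. Qed.

Lemma comp_legr m n T (f : 'I_(m + n) -> T) :
  (f \o @braid_leg m n) \o @rshift n m = f \o @lshift m n.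
Proof. by rewrite -braid_leg_rshift. Qed.

Lemma col_braid_split m n f g :
  col (corel_braid m n) f g <->
  g \o @lshift n m = f \o @rshift m n /\ g \o @rshift n m = f \o @lshift m n.
Proof.
split=> [/col_braid ->|[gl gr]].
  by rewrite comp_legl comp_legr.
apply/col_braid/ord_split_ext.
  by rewrite gl comp_legl.
by rewrite gr comp_legr.
Qed.

Definition joinf m n (T : Type) (f : 'I_m -> T) (g : 'I_n -> T)
    (k : 'I_(m + n)) : T :=
  match split k with inl i => f i | inr j => g j end.

Lemma joinfl m n (T : Type) (f : 'I_m -> T) (g : 'I_n -> T) :
  joinf f g \o @lshift m n = f.
Proof. by apply: funext => j; rewrite /= /joinf (unsplitK (inl j)). Qed.

Lemma joinfr m n (T : Type) (f : 'I_m -> T) (g : 'I_n -> T) :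
  joinf f g \o @rshift m n = g.
Proof. by apply: funext => j; rewrite /= /joinf (unsplitK (inr j)). Qed.

Lemma corel_isProp : isProp corelData.
Proof.
move=> m n a b [] {m n a b}.
- move=> m n c; apply: col_ext => f g; split=> [/col_comp[h [ch /col_id->]]|] //.
  by move=> cfg; apply/col_comp; exists g; split=> //; apply/col_id.
- move=> m n c; apply: col_ext => f g; split=> [/col_comp[h [/col_id->]]|] //.
  by move=> cfg; apply/col_comp; exists f; split=> //; apply/col_id.
- move=> m n p q c d e; apply: col_ext => f g; split.
    move=> /col_comp[h [/col_comp[k [ck dk]] eh]].
    by apply/col_comp; exists k; split=> //; apply/col_comp; exists h.
  move=> /col_comp[h [ch /col_comp[k [dk ek]]]].
  by apply/col_comp; exists k; split=> //; apply/col_comp; exists h.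
- move=> m n; apply: col_ext => f g; split.
    by move=> /col_tens[/col_id el /col_id er]; apply/col_id/ord_split_ext.
  by move=> /col_id->; apply/col_tens; split; apply/col_id.
- move=> m n p m' n' p' c d c' d'; apply: col_ext => f g; split.
    move=> /col_tens[/col_comp[h [ch dh]] /col_comp[h' [ch' dh']]].
    apply/col_comp; exists (joinf h h').
    by split; apply/col_tens; rewrite joinfl joinfr.
  move=> /col_comp[h [/col_tens[ch ch'] /col_tens[dh dh']]].
  apply/col_tens; split; apply/col_comp.
    by exists (h \o @lshift _ _).
  by exists (h \o @rshift _ _).
- move=> m n m' n' m'' n'' c d e; apply: col_ext => f g.
  have ll k k' k'' (h : 'I_(k + k' + k'') -> bool) :
      (h \o cast_ord (addnA k k' k'')) \o @lshift _ _
    = (h \o @lshift _ _) \o @lshift _ _.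
    by apply: funext => i; congr (h _); apply: val_inj.
  have rl k k' k'' (h : 'I_(k + k' + k'') -> bool) :
      ((h \o cast_ord (addnA k k' k'')) \o @rshift _ _) \o @lshift _ _
    = (h \o @lshift _ _) \o @rshift _ _.
    by apply: funext => i; congr (h _); apply: val_inj.
  have rr k k' k'' (h : 'I_(k + k' + k'') -> bool) :
      ((h \o cast_ord (addnA k k' k'')) \o @rshift _ _) \o @rshift _ _
    = h \o @rshift _ _.
    by apply: funext => i; congr (h _); apply: val_inj; rewrite /= addnA.
  split.
    move=> /col_cast /col_tens[] /[swap] /col_tens[].
    rewrite !ll !rl !rr => dfg efg cfg.
    by apply/col_tens; split=> //; apply/col_tens.
  move=> /col_tens[/col_tens[cfg dfg] efg].
  apply/col_cast/col_tens; rewrite !ll; split=> //.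
  by apply/col_tens; rewrite !rl !rr.
- move=> m n c; apply: col_ext => f g.
  have E k (h : 'I_k -> bool) : (h \o cast_ord (add0n k)) \o @rshift 0 k = h.
    by apply: funext => i; congr (h _); apply: val_inj.
  split=> [/col_cast/col_tens[_]|cfg]; first by rewrite !E.
  apply/col_cast/col_tens; rewrite !E; split=> //.
  by apply/col_id/funext => -[].
- move=> m n c; apply: col_ext => f g.
  have E k (h : 'I_k -> bool) : (h \o cast_ord (addn0 k)) \o @lshift k 0 = h.
    by apply: funext => i; congr (h _); apply: val_inj.
  split=> [/col_cast/col_tens[+ _]|cfg]; first by rewrite !E.
  apply/col_cast/col_tens; rewrite !E; split=> //.
  by apply/col_id/funext => -[].
- move=> m n m' n' c c'; apply: col_ext => f g; split.
    move=> /col_comp[h [/col_tens[ch ch'] /col_braid_split[gl gr]]].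
    apply/col_comp; exists (f \o @braid_leg m m').
    split; first exact/col_braid.
    by apply/col_tens; rewrite comp_legl comp_legr gl gr.
  move=> /col_comp[h [/col_braid_split[hl hr] /col_tens[ch ch']]].
  apply/col_comp; exists (joinf (g \o @rshift _ _) (g \o @lshift _ _)).
  split; last by apply/col_braid_split; rewrite joinfl joinfr.
  by apply/col_tens; rewrite joinfl joinfr -hl -hr.
- move=> m n; apply: col_ext => f g; split.
    move=> /col_comp[h [/col_braid_split[hl hr] /col_braid_split[gl gr]]].
    by apply/col_id/ord_split_ext; rewrite ?gl ?gr.
  move=> /col_id ->; apply/col_comp; exists (f \o @braid_leg m n).
  split; first exact/col_braid.
  by apply/col_braid_split; rewrite comp_legl comp_legr.
- move=> m n p; apply: col_ext => f g.
  have castE k l (e : k = l) (h : 'I_l -> bool) i j : val i = val j ->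
      h (cast_ord e i) = h j.
    by move=> ij; congr (h _); apply: val_inj.
  have fE i : f (cast_ord (addnA m n p) (lshift _ i))
            = f (lshift p (lshift n i)) by apply: castE.
  have fE' i : f (cast_ord (addnA m n p) (rshift m (lshift p i)))
            = f (lshift p (rshift m i)) by apply: castE.
  have fE'' i : f (cast_ord (addnA m n p) (rshift m (rshift n i)))
            = f (rshift (m + n) i) by apply: castE; rewrite /= addnA.
  have gE i : g (cast_ord (esym (addnA n p m)) (rshift (n + p) i))
            = g (rshift n (rshift p i)) by apply: castE; rewrite /= addnA.
  have gE' i : g (cast_ord (esym (addnA n p m)) (lshift m (lshift p i)))
            = g (lshift (p + m) i) by apply: castE.
  have gE'' i : g (cast_ord (esym (addnA n p m)) (lshift m (rshift n i)))
            = g (rshift n (lshift m i)) by apply: castE.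
  have hE (h : 'I_(n + m + p) -> bool) i :
      h (cast_ord (addnA n m p) (lshift (m + p) i)) = h (lshift p (lshift m i))
    by apply: castE.
  have hE' (h : 'I_(n + m + p) -> bool) i :
      h (cast_ord (addnA n m p) (rshift n (lshift p i)))
      = h (lshift p (rshift n i))
    by apply: castE.
  have hE'' (h : 'I_(n + m + p) -> bool) i :
      h (cast_ord (addnA n m p) (rshift n (rshift m i)))
      = h (rshift (n + m) i)
    by apply: castE; rewrite /= addnA.
  have idE k (h : 'I_k -> bool) e : h \o cast_ord e = h.
    by apply: funext => i; apply: castE.
  split.
    move=> /col_cast /col_braid_split[gl gr]; apply/col_comp.
    exists (joinf (joinf (f \o @lshift _ _ \o @rshift _ _)
                         (f \o @lshift _ _ \o @lshift _ _))
                  (f \o @rshift _ _)).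
    split.
      apply/col_tens; rewrite joinfl joinfr; split; last exact/col_id.
      by apply/col_braid_split; rewrite joinfl joinfr.
    set k := joinf _ _.
    have kl i : k (lshift p (lshift m i)) = f (lshift p (rshift m i)).
      by rewrite /k /joinf (unsplitK (inl (lshift m i))) (unsplitK (inl i)).
    have km i : k (lshift p (rshift n i)) = f (lshift p (lshift n i)).
      by rewrite /k /joinf (unsplitK (inl (rshift n i))) (unsplitK (inr i)).
    have kr i : k (rshift (n + m) i) = f (rshift (m + n) i).
      by rewrite /k /joinf (unsplitK (inr i)).
    apply/col_cast/col_tens; split.
      apply/col_id/funext => i /=; rewrite cast_ord_id hE kl -fE' -gE'.
      exact: (congr1 (@^~ (lshift p i)) gl).
    apply/col_braid_split; split; apply: funext => i; rewrite /= cast_ord_id.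
      rewrite hE'' kr -fE'' -gE''; exact: (congr1 (@^~ (rshift n i)) gl).
    by rewrite hE' km -fE -gE; exact: (congr1 (@^~ i) gr).
  move=> /col_comp[h [/col_tens[/col_braid_split[hl hm] /col_id hr]]].
  move=> /col_cast/col_tens[/col_id gl /col_braid_split[gm gr]].
  apply/col_cast/col_braid_split; split; last first.
    apply: funext => i; rewrite /= gE fE.
    have := congr1 (@^~ i) gr; rewrite /= cast_ord_id hE' => ->.
    exact: (congr1 (@^~ i) hm).
  apply: ord_split_ext; apply: funext => i /=.
    rewrite gE' fE'; have := congr1 (@^~ i) gl; rewrite /= cast_ord_id hE => ->.
    exact: (congr1 (@^~ i) hl).
  rewrite gE'' fE''; have := congr1 (@^~ i) gm.
  rewrite /= cast_ord_id hE'' => ->; exact: (congr1 (@^~ i) hr).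
Qed.

Definition FinCorel : prop := Prop_ corel_isProp.

(* Main.v *)
Require Import Defs.
From mathcomp Require Import all_boot boolp zify.

Set Implicit Arguments.
Unset Strict Implicit.
Unset Printing Implicit Defensive.

Local Open Scope nat_scope.
Local Open Scope prop_scope.

(** The one-part corelations satisfy the laws of an extraspecial commutative
Frobenius monoid, so sending the generators to them defines a morphism of
props ([frobProp_to_FinCorel]).  It remains to see that this morphism is
bijective on hom-sets.

A Frobenius monoid is its own dual: composing with counit and multiplication
bends the first output of a morphism round into an input, and this can be
undone by unit and comultiplication ([bendK], [unbendK]).  As bending is
preserved by morphisms of props, only the hom-sets n -> 0 matter
([bijective_on_effects]); their elements are called effects below.

Effects have a normal form.  A function f from the n inputs to k parts gives a
morphism [wires k n f] from n to k, which multiplies together the inputs that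
have the same value, and then an effect [effect k n f], which discards the k
parts.  In FinCorel this effect is the kernel of f ([colN_effect]), and every
partition is the kernel of some f ([onePart_effect_surj]).  So the theorem
follows from two statements about the presented prop.

First, every effect has a normal form ([frobProp_effect]), because normal forms
survive precomposition with the generators.  Multiplications, units and
crossings only change f; a counit adds a part; a comultiplication merges two
parts, and merging passes through [wires] down to the discarded parts
([merge_join], [merge_joinl], [effect_merge]).

Secondly, [effect k n f] depends only on the kernel of f ([eq_ker_effect]).  It
is enough to rename one value i of f to a value j that f does not take
([effect_rename]).  Since j is an empty part, merging it with i changes nothing
once the parts are discarded; here the extra law removes the empty part.  After
the merge, an input may be attached to i or to j indifferently.

New wires are always added on the left, where 1 + n is convertible to n.+1, so
that almost no transport along equalities of natural numbers is needed. *)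

(** * Calculus in a prop *)

Section PropTheory.
Variable P : prop.

Lemma pcompl m n (f : P m n) : pid n ∘ f = f.
Proof. by apply: propP; constructor. Qed.

Lemma pcompr m n (f : P m n) : f ∘ pid m = f.
Proof. by apply: propP; constructor. Qed.

Lemma pcompA m n p q (f : P m n) (g : P n p) (h : P p q) :
  h ∘ (g ∘ f) = h ∘ g ∘ f.
Proof. by apply: propP; constructor. Qed.

Lemma ptens_id m n : pid m ⊗ pid n = pid (m + n) :> P _ _.
Proof. by apply: propP; constructor. Qed.

Lemma ptens_comp m n p m' n' p' (f : P m n) (g : P n p) (f' : P m' n')
    (g' : P n' p') :
  (g ∘ f) ⊗ (g' ∘ f') = (g ⊗ g') ∘ (f ⊗ f').
Proof. by apply: propP; constructor. Qed.

Lemma cast_hom_id m n (em : m = m) (en : n = n) (f : P m n) :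
  cast_hom em en f = f.
Proof. by rewrite (eq_axiomK em) (eq_axiomK en). Qed.

Lemma ptensA m n m' n' m'' n'' (f : P m n) (g : P m' n') (h : P m'' n'') :
  (f ⊗ g) ⊗ h = cast_hom (addnA m m' m'') (addnA n n' n'') (f ⊗ (g ⊗ h)).
Proof. by apply: esym; apply: propP; constructor. Qed.

Lemma pbraid_nat m n m' n' (f : P m n) (f' : P m' n') :
  pbraid n n' ∘ (f ⊗ f') = (f' ⊗ f) ∘ pbraid m m'.
Proof. by apply: propP; constructor. Qed.

Lemma pbraidK m n : pbraid n m ∘ pbraid m n = pid (m + n) :> P _ _.
Proof. by apply: propP; constructor. Qed.

Lemma pbraid_hex m n p :
  cast_hom (addnA m n p) (esym (addnA n p m)) (pbraid m (n + p)) =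
  cast_hom (addnA n m p) (erefl _) (pid n ⊗ pbraid m p) ∘ (pbraid m n ⊗ pid p)
  :> P _ _.
Proof. by apply: propP; constructor. Qed.

Lemma ptens0l m n (f : P m n) : (pid 0 ⊗ f : P m n) = f.
Proof.
have := propP (law_tens_unitl f); exact: etrans (esym (cast_hom_id _ _ _)).
Qed.

Lemma interchange m n p q (f : P m n) (g : P p q) :
  (f ⊗ pid q) ∘ (pid m ⊗ g) = (pid n ⊗ g) ∘ (f ⊗ pid p).
Proof. by rewrite -!ptens_comp !pcompl !pcompr. Qed.

Lemma tens_split_comp m n p q (f : P m n) (g : P p q) :
  f ⊗ g = (f ⊗ pid q) ∘ (pid m ⊗ g).
Proof. by rewrite -!ptens_comp !pcompl !pcompr. Qed.

(** Composites are kept associated to the right; these lemmas turn an equation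
between short composites into one that rewrites in the middle of a long one. *)
Lemma reassoc m n n' p q (a : P n p) (b : P m n) (c : P n' p) (d : P m n') 
    (e : a ∘ b = c ∘ d) (x : P q m) : a ∘ (b ∘ x) = c ∘ (d ∘ x).
Proof. by rewrite pcompA e pcompA. Qed.

Lemma reassoc1 m n p q (a : P n p) (b : P m n) c (e : a ∘ b = c) (x : P q m) :
  a ∘ (b ∘ x) = c ∘ x.
Proof. by rewrite pcompA e. Qed.

Lemma reassoc2 m n p q r (a : P p q) (b : P n p) (c : P m n) d
    (e : a ∘ (b ∘ c) = d) (x : P r m) :
  a ∘ (b ∘ (c ∘ x)) = d ∘ x.
Proof. by rewrite -e -!pcompA. Qed.

Lemma reassocK m n q (a : P n m) (b : P m n) (e : a ∘ b = pid m) (x : P q m) :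
  a ∘ (b ∘ x) = x.
Proof. by rewrite pcompA e pcompl. Qed.

(** A wire is added on the left, with the type written so that no cast is
needed to iterate. *)
Definition up m n (f : P m n) : P m.+1 n.+1 := pid 1 ⊗ f.

Lemma up_id n : up (pid n) = pid n.+1.
Proof. exact: (ptens_id 1 n). Qed.

Lemma up_comp m n p (g : P n p) (f : P m n) : up (g ∘ f) = up g ∘ up f.
Proof. rewrite /up -{1}(pcompl (pid 1)); exact: (ptens_comp (pid 1) (pid 1) f g). Qed.

Lemma up_tens m n m' n' (f : P m n) (g : P m' n') :
  (up f ⊗ g : P (m + m').+1 (n + n').+1) = up (f ⊗ g).
Proof. exact: (etrans (ptensA (pid 1) f g) (cast_hom_id _ _ _)). Qed.

Lemma tensS m p q (f : P p q) :
  (pid m.+1 ⊗ f : P (m + p).+1 (m + q).+1) = up (pid m ⊗ f).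
Proof. by rewrite -up_tens up_id. Qed.

Lemma up2 m n (f : P m n) : (pid 2 ⊗ f : P m.+2 n.+2) = up (up f).
Proof. exact: (tensS 1 f). Qed.

(** The suffix [W] marks a morphism acting on the leftmost wires, beside [b]
idle wires. *)
Definition swapW b : P b.+2 b.+2 := pbraid 1 1 ⊗ pid b.

Lemma swap_nat m n (f : P m n) :
  swapW n ∘ up (up f) = up (up f) ∘ swapW m.
Proof. by rewrite -!up2; exact: (interchange (pbraid 1 1) f). Qed.

Lemma whisk_comp b m n p (g : P n p) (f : P m n) :
  (g ∘ f) ⊗ pid b = (g ⊗ pid b) ∘ (f ⊗ pid b).
Proof. by rewrite -ptens_comp pcompl. Qed.

Lemma swapK b : swapW b ∘ swapW b = pid b.+2.
Proof.
apply: (etrans (esym (whisk_comp b (pbraid 1 1) (pbraid 1 1)))).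
by rewrite pbraidK; exact: (ptens_id 2 b).
Qed.

Lemma tens0r m n (f : P m n) :
  cast_hom (addn0 m) (addn0 n) (f ⊗ pid 0) = f.
Proof. exact: propP (law_tens_unitr f). Qed.

Lemma whiskA m n (f : P m n) a b :
  (f ⊗ pid a) ⊗ pid b =
  cast_hom (addnA m a b) (addnA n a b) (f ⊗ pid (a + b)).
Proof. by rewrite ptensA ptens_id. Qed.

(** The hexagon makes this braiding idempotent, and it is invertible. *)
Lemma pbraid00 : pbraid 0 0 = pid 0 :> P 0 0.
Proof.
have e : pbraid 0 0 = pbraid 0 0 ∘ pbraid 0 0 :> P 0 0.
  apply: (etrans (esym (cast_hom_id _ _ _)) (etrans (@pbraid_hex 0 0 0) _)).
  rewrite cast_hom_id ptens0l; congr (_ ∘ _).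
  exact: (etrans (esym (cast_hom_id _ _ _)) (tens0r _)).
by rewrite e (pbraidK 0 0).
Qed.

Lemma pbraid10 : pbraid 1 0 = pid 1 :> P 1 1.
Proof.
have e : pbraid 1 0 = (pbraid 1 0 : P 1 1) ∘ pbraid 1 0 :> P 1 1.
  apply: (etrans (esym (cast_hom_id _ _ _)) (etrans (@pbraid_hex 1 0 0) _)).
  rewrite cast_hom_id ptens0l; congr (_ ∘ _).
  exact: (etrans (esym (cast_hom_id _ _ _)) (tens0r _)).
have k : (pbraid 0 1 : P 1 1) ∘ (pbraid 1 0 : P 1 1) = pid 1.
  exact: (pbraidK 1 0).
by rewrite -[LHS](reassocK k) -e k.
Qed.

Lemma pbraid01 : pbraid 0 1 = pid 1 :> P 1 1.
Proof. rewrite -[LHS]pcompr -{1}pbraid10; exact: (pbraidK 1 0). Qed.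

Local Notation sw := (pbraid 1 1 : P 2 2).

Lemma swapWA b : ((sw ⊗ pid 1 : P 3 3) ⊗ pid b : P b.+3 b.+3) = swapW b.+1.
Proof. exact: (etrans (whiskA sw 1 b) (cast_hom_id _ _ _)). Qed.

Lemma pbraid12 : pbraid 1 2 = up sw ∘ swapW 1 :> P 3 3.
Proof.
apply: (etrans (esym (cast_hom_id _ _ _)) (etrans (@pbraid_hex 1 1 1) _)).
by rewrite cast_hom_id.
Qed.

(** The hexagon computes the inverse braiding. *)
Lemma pbraid21 : pbraid 2 1 = swapW 1 ∘ up sw :> P 3 3.
Proof.
have e : (pbraid 1 2 : P 3 3) ∘ (swapW 1 ∘ up sw) = pid 3.
  rewrite pbraid12 -!pcompA (reassocK (swapK 1)) -up_comp.
  by rewrite [sw ∘ sw](pbraidK 1 1) up_id.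
rewrite -[RHS]pcompl.
have <- : pbraid 2 1 ∘ (pbraid 1 2 : P 3 3) = pid 3 by exact: (pbraidK 1 2).
by rewrite -pcompA e pcompr.
Qed.

(** This is naturality of the braiding of one wire past two, applied to the
crossing of those two. *)
Lemma yang_baxter b :
  up (swapW b) ∘ (swapW b.+1 ∘ up (swapW b)) =
  swapW b.+1 ∘ (up (swapW b) ∘ swapW b.+1).
Proof.
have e : up sw ∘ swapW 1 ∘ up sw = swapW 1 ∘ (up sw ∘ swapW 1).
  rewrite -pbraid12; exact: (pbraid_nat (pid 1) sw).
have := congr1 (fun f => f ⊗ pid b) e.
rewrite !whisk_comp swapWA up_tens -/(swapW b) => <-.
by rewrite pcompA.
Qed.

Section Whiskered.
Variables (f21 : P 2 1) (f01 : P 0 1) (f12 : P 1 2) (f10 : P 1 0).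

Lemma nat21 m n (f : P m n) :
  (f21 ⊗ pid n : P n.+2 n.+1) ∘ up (up f) = up f ∘ (f21 ⊗ pid m).
Proof. by rewrite -up2; exact: (interchange f21 f). Qed.

Lemma nat12 m n (f : P m n) :
  (f12 ⊗ pid n : P n.+1 n.+2) ∘ up f = up (up f) ∘ (f12 ⊗ pid m).
Proof. by rewrite -up2; exact: (interchange f12 f). Qed.

Lemma nat01 m n (f : P m n) :
  (f01 ⊗ pid n : P n n.+1) ∘ f = up f ∘ (f01 ⊗ pid m).
Proof. by rewrite -{1}(ptens0l f); exact: (interchange f01 f). Qed.

Lemma nat10 m n (f : P m n) :
  (f10 ⊗ pid n : P n.+1 n) ∘ up f = f ∘ (f10 ⊗ pid m).
Proof. by rewrite -{2}(ptens0l f); exact: (interchange f10 f). Qed.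

Lemma swap21 b :
  swapW b ∘ (f21 ⊗ pid b.+1 : P b.+3 b.+2) =
  up (f21 ⊗ pid b) ∘ (swapW b.+1 ∘ up (swapW b)).
Proof.
have e : sw ∘ (f21 ⊗ pid 1 : P 3 2) = up f21 ∘ (swapW 1 ∘ up sw).
  rewrite -pbraid21; exact: (pbraid_nat f21 (pid 1)).
have := congr1 (fun f => f ⊗ pid b) e.
rewrite !whisk_comp swapWA !up_tens -/(swapW b) => <-.
congr (_ ∘ _); exact: (esym (etrans (whiskA f21 1 b) (cast_hom_id _ _ _))).
Qed.

Lemma swap12 b :
  swapW b.+1 ∘ (up (swapW b) ∘ (f12 ⊗ pid b.+1 : P b.+2 b.+3)) =
  up (f12 ⊗ pid b) ∘ swapW b.
Proof.
have e : swapW 1 ∘ (up sw ∘ (f12 ⊗ pid 1 : P 2 3)) = up f12 ∘ sw.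
  rewrite pcompA -pbraid21; exact: (pbraid_nat f12 (pid 1)).
have := congr1 (fun f => f ⊗ pid b) e.
rewrite !whisk_comp swapWA !up_tens -/(swapW b) => <-.
congr (_ ∘ (_ ∘ _)); exact: (esym (etrans (whiskA f12 1 b) (cast_hom_id _ _ _))).
Qed.

Lemma swap01 b :
  swapW b ∘ (f01 ⊗ pid b.+1 : P b.+1 b.+2) = up (f01 ⊗ pid b).
Proof.
have e : sw ∘ (f01 ⊗ pid 1 : P 1 2) = up f01.
  have := congr1 (fun z => up f01 ∘ z) pbraid01; rewrite pcompr => <-.
  exact: (pbraid_nat f01 (pid 1)).
have := congr1 (fun f => f ⊗ pid b) e.
rewrite !whisk_comp !up_tens -/(swapW b) => <-.
congr (_ ∘ _); exact: (esym (etrans (whiskA f01 1 b) (cast_hom_id _ _ _))).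
Qed.

Lemma swap10 b :
  (f10 ⊗ pid b.+1 : P b.+2 b.+1) ∘ swapW b = up (f10 ⊗ pid b).
Proof.
have e : (f10 ⊗ pid 1 : P 2 1) = up f10 ∘ sw.
  have <- : (pbraid 0 1 : P 1 1) ∘ (f10 ⊗ pid 1 : P 2 1) = f10 ⊗ pid 1.
    by rewrite pbraid01 pcompl.
  exact: (pbraid_nat f10 (pid 1)).
have := congr1 (fun f => f ⊗ pid b) e.
rewrite !whisk_comp !up_tens -/(swapW b) => e'.
have -> : (f10 ⊗ pid b.+1 : P b.+2 b.+1) = up (f10 ⊗ pid b) ∘ swapW b.
  apply: etrans e'; exact: (esym (etrans (whiskA f10 1 b) (cast_hom_id _ _ _))).
by rewrite -pcompA swapK pcompr.
Qed.

End Whiskered.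

End PropTheory.

(** * Effects in normal form *)

Section SpiderDefs.
Variables (P : prop) (mu : P 2 1) (iota : P 0 1) (delta : P 1 2)
  (epsilon : P 1 0).

Definition muW b : P b.+2 b.+1 := mu ⊗ pid b.
Definition iotaW b : P b b.+1 := iota ⊗ pid b.
Definition deltaW b : P b.+1 b.+2 := delta ⊗ pid b.
Definition epsW b : P b.+1 b := epsilon ⊗ pid b.

(** The first wire crosses [i] of the [k] others and is multiplied into the
next one.  The case [k = 0], where there is nothing to join, is a default
value. *)
Fixpoint join k i : P k.+1 k :=
  match k, i with
  | 0, _ => epsW 0
  | k.+1, 0 => muW k
  | k.+1, i.+1 => up (join k i) ∘ swapW P k
  end.

Fixpoint units k : P 0 k :=
  if k is k.+1 then iotaW k ∘ units k else pid 0.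

(** An empty part is inserted at position [j <= k]. *)
Fixpoint pad k j : P k k.+1 :=
  match k with
  | 0 => iotaW 0
  | k.+1 => if j is j.+1 then up (pad k j) else iotaW k.+1
  end.

Fixpoint counits k : P k 0 :=
  if k is k.+1 then counits k ∘ epsW k else pid 0.

(** The inputs are indexed by [x < n] and the parts by [i < k]; a function on
all natural numbers is used in order to shift it without dependent types. *)
Fixpoint wires k n (f : nat -> nat) : P n k :=
  if n is n.+1 then join k (f 0) ∘ up (wires k n (f \o S)) else units k.

Definition effect k n f : P n 0 := counits k ∘ wires k n f.

End SpiderDefs.

(** * The Frobenius laws beside idle wires *)

Section Spiders.
Variables (P : prop) (mu : P 2 1) (iota : P 0 1) (delta : P 1 2)
  (epsilon : P 1 0).
Hypothesis law : forall m n (e : frob_eqn m n),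
  (frob_sides mu iota delta epsilon e).1 = (frob_sides mu iota delta epsilon e).2.

Local Notation muW := (muW mu).
Local Notation iotaW := (iotaW iota).
Local Notation deltaW := (deltaW delta).
Local Notation epsW := (epsW epsilon).
Local Notation join := (join mu epsilon).
Local Notation units := (units iota).
Local Notation pad := (pad iota).
Local Notation counits := (counits epsilon).
Local Notation wires := (wires mu iota epsilon).
Local Notation effect := (effect mu iota epsilon).
Local Notation swapW := (swapW P).

Lemma muW_nat m n (f : P m n) : muW n ∘ up (up f) = up f ∘ muW m.
Proof. exact: nat21. Qed.
Lemma iotaW_nat m n (f : P m n) : iotaW n ∘ f = up f ∘ iotaW m.
Proof. exact: nat01. Qed.
Lemma deltaW_nat m n (f : P m n) : deltaW n ∘ up f = up (up f) ∘ deltaW m.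
Proof. exact: nat12. Qed.
Lemma epsW_nat m n (f : P m n) : epsW n ∘ up f = f ∘ epsW m.
Proof. exact: nat10. Qed.

Lemma swap_muW b :
  swapW b ∘ muW b.+1 = up (muW b) ∘ (swapW b.+1 ∘ up (swapW b)).
Proof. exact: swap21. Qed.
Lemma swap_iotaW b : swapW b ∘ iotaW b.+1 = up (iotaW b).
Proof. exact: swap01. Qed.
Lemma swap_deltaW b :
  swapW b.+1 ∘ (up (swapW b) ∘ deltaW b.+1) = up (deltaW b) ∘ swapW b.
Proof. exact: swap12. Qed.
Lemma epsW_swap b : epsW b.+1 ∘ swapW b = up (epsW b).
Proof. exact: swap10. Qed.

Lemma muW_assoc b : muW b ∘ muW b.+1 = muW b ∘ up (muW b).
Proof.
have := congr1 (fun f => f ⊗ pid b) (law e_assoc).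
rewrite /= !whisk_comp up_tens => <-.
congr (_ ∘ _); exact: (esym (etrans (whiskA mu 1 b) (cast_hom_id _ _ _))).
Qed.

Lemma muW_unitl b : muW b ∘ iotaW b.+1 = pid b.+1.
Proof.
have := congr1 (fun f => f ⊗ pid b) (law e_unitl).
rewrite /= !whisk_comp ptens_id => <-.
congr (_ ∘ _); exact: (esym (etrans (whiskA iota 1 b) (cast_hom_id _ _ _))).
Qed.

Lemma muW_unitr b : muW b ∘ up (iotaW b) = pid b.+1.
Proof.
have := congr1 (fun f => f ⊗ pid b) (law e_unitr).
by rewrite /= !whisk_comp up_tens ptens_id.
Qed.

Lemma epsW_deltaW b : epsW b.+1 ∘ deltaW b = pid b.+1.
Proof.
have := congr1 (fun f => f ⊗ pid b) (law e_counitl).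
rewrite /= !whisk_comp ptens_id => <-.
congr (_ ∘ _); exact: (esym (etrans (whiskA epsilon 1 b) (cast_hom_id _ _ _))).
Qed.

Lemma up_epsW_deltaW b : up (epsW b) ∘ deltaW b = pid b.+1.
Proof.
have := congr1 (fun f => f ⊗ pid b) (law e_counitr).
by rewrite /= !whisk_comp up_tens ptens_id.
Qed.

Lemma frobW_l b : up (muW b) ∘ deltaW b.+1 = deltaW b ∘ muW b.
Proof.
have := congr1 (fun f => f ⊗ pid b) (law e_frobl).
rewrite /= !whisk_comp up_tens => <-.
congr (_ ∘ _); exact: (esym (etrans (whiskA delta 1 b) (cast_hom_id _ _ _))).
Qed.

Lemma frobW_r b : muW b.+1 ∘ up (deltaW b) = deltaW b ∘ muW b.
Proof.
have := congr1 (fun f => f ⊗ pid b) (law e_frobr).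
rewrite /= !whisk_comp up_tens => ->.
congr (_ ∘ _); exact: (esym (etrans (whiskA mu 1 b) (cast_hom_id _ _ _))).
Qed.

Lemma muW_comm b : muW b ∘ swapW b = muW b.
Proof.
have := congr1 (fun f => f ⊗ pid b) (law e_comm).
by rewrite /= !whisk_comp.
Qed.

Lemma muW_deltaW b : muW b ∘ deltaW b = pid b.+1.
Proof.
have := congr1 (fun f => f ⊗ pid b) (law e_special).
by rewrite /= !whisk_comp ptens_id.
Qed.

Lemma epsW_iotaW b : epsW b ∘ iotaW b = pid b.
Proof.
have := congr1 (fun f => f ⊗ pid b) (law e_extra).
by rewrite /= !whisk_comp ptens_id.
Qed.

(** * Wires joined to parts *)

(** The next three lemmas say that each part carries an action of the monoid
on the [k] parts, and that the actions on all parts commute. *)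
Lemma join_mu k i : i < k -> join k i ∘ muW k = join k i ∘ up (join k i).
Proof.
elim: k i => [//|k IHk] [|i] ik /=; first exact: muW_assoc.
rewrite -pcompA swap_muW (reassoc1 (esym (up_comp _ _))) IHk // !up_comp -!pcompA.
by rewrite (reassoc (swap_nat _)).
Qed.

Lemma join_iota k i : i < k -> join k i ∘ iotaW k = pid k.
Proof.
elim: k i => [//|k IHk] [|i] ik /=; first exact: muW_unitl.
by rewrite -pcompA swap_iotaW -up_comp IHk // up_id.
Qed.

Lemma join_comm k i j : i < k -> j < k ->
  join k i ∘ up (join k j) = join k j ∘ (up (join k i) ∘ swapW k).
Proof.
elim: k i j => [//|k IHk].
have mixed j : muW k ∘ up (up (join k j) ∘ swapW k)
    = up (join k j) ∘ swapW k ∘ (up (muW k) ∘ swapW k.+1).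
  have e : up (muW k) ∘ swapW k.+1 = swapW k ∘ (muW k.+1 ∘ up (swapW k)).
    rewrite (reassoc (swap_muW k)) -!pcompA -up_comp.
    by rewrite swapK up_id pcompr.
  rewrite e -!pcompA (reassocK (swapK P k)) up_comp pcompA muW_nat.
  by rewrite pcompA.
move=> [|i] [|j] ik jk /=.
- by rewrite pcompA -muW_assoc -pcompA muW_comm.
- exact: mixed.
- rewrite [in RHS]pcompA mixed.
  by rewrite -!pcompA swapK pcompr.
- rewrite !up_comp -!pcompA (reassoc (swap_nat _)) (reassoc1 (esym (up_comp _ _))).
  rewrite IHk // !up_comp -!pcompA (reassoc (swap_nat _)) yang_baxter.
  by [].
Qed.

Lemma wires_ext k n f g : (forall x, x < n -> f x = g x) ->
  wires k n f = wires k n g.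
Proof.
elim: n f g => [//|n IHn] f g fg /=.
by rewrite fg // (IHn (f \o S) (g \o S)) // => x xn; apply: fg.
Qed.

(** * Merging two parts *)

(** A cup [delta o iota] whose two legs are joined to the parts [i] and [j]. *)
Definition merge k i j : P k k :=
  join k i ∘ (up (join k j) ∘ (deltaW k ∘ iotaW k)).

Lemma swap_cup b : swapW b.+1 ∘ (up (swapW b) ∘ (deltaW b.+1 ∘ iotaW b.+1))
  = up (deltaW b ∘ iotaW b).
Proof.
by rewrite (pcompA _ (deltaW _)) pcompA swap_deltaW -pcompA swap_iotaW up_comp.
Qed.

Lemma cup_nat m n (f : P m n) :
  deltaW n ∘ (iotaW n ∘ f) = up (up f) ∘ (deltaW m ∘ iotaW m).
Proof. by rewrite iotaW_nat (reassoc (deltaW_nat _)). Qed.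

(** The cup is joined to the parts by actions that commute with the action on
the part [l]. *)
Lemma merge_join k i j l : i < k -> j < k -> l < k ->
  merge k i j ∘ join k l = join k l ∘ up (merge k i j).
Proof.
move=> ik jk lk; rewrite /merge -!pcompA cup_nat.
rewrite (reassoc1 (esym (up_comp _ _))) join_comm // !up_comp -!pcompA.
rewrite (reassoc (join_comm ik lk)) -!pcompA (reassoc (swap_nat _)) -up_comp.
by rewrite swap_cup !up_comp.
Qed.

(** By the Frobenius law, a cup with one leg multiplied by a wire is the
comultiplication of that wire.  This expresses a comultiplication followed by
[wires] through [merge]; with the next lemma it also shows that the parts [i]
and [j] cannot be told apart once they are merged. *)
Lemma merge_joinl k i j : i < k -> j < k ->
  merge k i j ∘ join k i = join k i ∘ (up (join k j) ∘ deltaW k).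
Proof.
move=> ik jk; rewrite merge_join // /merge !up_comp.
rewrite (reassoc (esym (join_mu ik))) (reassoc (muW_nat _)).
by rewrite (reassoc (frobW_r _)) muW_unitr pcompr.
Qed.

Lemma merge_joinr k i j : i < k -> j < k ->
  merge k i j ∘ join k j = join k i ∘ (up (join k j) ∘ deltaW k).
Proof.
move=> ik jk; rewrite /merge -!pcompA cup_nat.
rewrite (reassoc1 (esym (up_comp _ _))) -join_mu // up_comp -!pcompA.
congr (_ ∘ (_ ∘ _)).
by rewrite (reassoc (frobW_l _)) muW_unitl pcompr.
Qed.

Lemma merge_join_eq k i j l l' : i < k -> j < k ->
  [|| l == l', (l == i) && (l' == j) | (l == j) && (l' == i)] ->
  merge k i j ∘ join k l = merge k i j ∘ join k l'.
Proof.
move=> ik jk /or3P[/eqP-> //|/andP[/eqP-> /eqP->]|/andP[/eqP-> /eqP->]];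
by rewrite merge_joinl // merge_joinr.
Qed.

(** The merge passes up to each joined wire in turn, where it makes [i] and [j]
interchangeable. *)
Lemma merge_wires k i j n f g : i < k -> j < k ->
  (forall x, x < n -> g x < k) ->
  (forall x, x < n ->
    [|| f x == g x, (f x == i) && (g x == j) | (f x == j) && (g x == i)]) ->
  merge k i j ∘ wires k n f = merge k i j ∘ wires k n g.
Proof.
move=> ik jk; elim: n f g => [//|n IHn] f g gk fg /=.
rewrite !pcompA (merge_join_eq ik jk (fg 0 isT)) merge_join ?gk //.
rewrite -(pcompA _ (up _)) -(pcompA _ (up (merge _ _ _))) -!up_comp.
by rewrite (IHn _ (g \o S)) // => x xn; [exact: gk | exact: fg].
Qed.

Lemma pad_join k j i : j <= k -> i < k ->
  pad k j ∘ join k i = join k.+1 (bump j i) ∘ up (pad k j).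
Proof.
have pad0 k' i' : iotaW k' ∘ join k' i' = join k'.+1 i'.+1 ∘ up (iotaW k').
  by rewrite iotaW_nat -pcompA -swap_iotaW (reassocK (swapK _ _)).
elim: k j i => [//|k IHk] [|j] i jk ik; first exact: pad0.
case: i ik => [|i] ik; first by rewrite /= muW_nat.
rewrite bumpS [LHS]/= pcompA -up_comp IHk // up_comp -!pcompA.
by rewrite -swap_nat pcompA.
Qed.

Lemma pad_units k j : j <= k -> pad k j ∘ units k = units k.+1.
Proof.
elim: k j => [//|k IHk] [|j] jk //=.
by rewrite pcompA -iotaW_nat -pcompA IHk.
Qed.

Lemma pad_wires k j n f : j <= k -> (forall x, x < n -> f x < k) ->
  pad k j ∘ wires k n f = wires k.+1 n (bump j \o f).
Proof.
move=> jk; elim: n f => [|n IHn] f fk; first exact: pad_units.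
rewrite [LHS]/= pcompA pad_join ?fk // -pcompA -up_comp IHn // => x xn.
exact: fk.
Qed.

Lemma joinS k i : join k.+1 i.+1 = up (join k i) ∘ swapW k.
Proof. by []. Qed.

Lemma counitsS k : counits k.+1 = counits k ∘ epsW k.
Proof. by []. Qed.

(** The extra law: an empty part can be discarded. *)
Lemma counits_pad k j : counits k.+1 ∘ pad k j = counits k.
Proof.
elim: k j => [|k IHk] [|j]; rewrite counitsS -pcompA ?epsW_iotaW ?pcompr //.
by rewrite epsW_nat pcompA IHk.
Qed.

(** A wire joined to an empty part makes up the whole of that part. *)
Lemma counits_join_pad k j : j <= k ->
  counits k.+1 ∘ (join k.+1 j ∘ up (pad k j)) = counits k.+1.
Proof.
elim: k j => [|k IHk] [|j] jk //; try by rewrite [join _ _]/= muW_unitr pcompr.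
rewrite (joinS k.+1) (counitsS k.+1) [pad _ _]/=.
(* These are made opaque, as rewriting would unfold them. *)
have := counitsS k; have := IHk j jk.
move: (counits k.+1) (join k.+1 j) (pad k j) => c J u e cE.
rewrite -!pcompA swap_nat (reassoc (epsW_nat _)) (reassoc (epsW_nat _)) epsW_swap.
by rewrite (reassoc2 e) cE -!pcompA epsW_nat.
Qed.

(** Merging with an empty part is invisible after discarding: the leg of the
cup at the empty part is discarded, which leaves a unit joined to the other
part.  The two variants differ in the leg concerned, hence in the counit law
that is used. *)
Lemma counits_merge_pad k i j : i < k -> j <= k ->
  counits k.+1 ∘ (merge k.+1 (bump j i) j ∘ pad k j) = counits k.
Proof.
move=> ik jk.
have bik : bump j i < k.+1 by rewrite /bump; lia.
have -> : merge k.+1 (bump j i) j ∘ pad k j = join k.+1 j ∘ (up (pad k j) ∘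
    (up (join k i) ∘ (swapW k ∘ (deltaW k ∘ iotaW k)))).
  rewrite /merge -!pcompA cup_nat (reassoc (join_comm _ _)) //.
  rewrite -!pcompA (reassoc (swap_nat _)) (reassoc1 (esym (up_comp _ _))).
  by rewrite -pad_join // up_comp -!pcompA.
rewrite (reassoc2 (counits_join_pad jk)) counitsS -!pcompA.
rewrite (reassoc (epsW_nat _)) (reassoc1 (epsW_swap _)) (reassocK (up_epsW_deltaW _)).
by rewrite join_iota // pcompr.
Qed.

Lemma counits_merge_padr k i j : i < k -> j <= k ->
  counits k.+1 ∘ (merge k.+1 j (bump j i) ∘ pad k j) = counits k.
Proof.
move=> ik jk.
have bik : bump j i < k.+1 by rewrite /bump; lia.
have -> : merge k.+1 j (bump j i) ∘ pad k j = join k.+1 j ∘ (up (pad k j) ∘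
    (up (join k i) ∘ (deltaW k ∘ iotaW k))).
  rewrite /merge -!pcompA cup_nat (reassoc1 (esym (up_comp _ _))).
  by rewrite -pad_join // up_comp -!pcompA.
rewrite (reassoc2 (counits_join_pad jk)) counitsS -!pcompA.
rewrite (reassoc (epsW_nat _)) (reassocK (epsW_deltaW _)).
by rewrite join_iota // pcompr.
Qed.

Lemma effect_pad k j n f : j <= k -> (forall x, x < n -> f x < k) ->
  effect k.+1 n (bump j \o f) = effect k n f.
Proof.
by move=> jk fk; rewrite /effect -pad_wires // pcompA counits_pad.
Qed.

Lemma bump_split j i k : j <= k -> i < k.+1 -> i != j ->
  exists2 i', i' < k & i = bump j i'.
Proof. by move=> jk ik ij; exists (unbump j i); rewrite /bump /unbump; lia. Qed.

Lemma effect_merge k i j n f : i < k -> j < k -> i != j ->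
  (forall x, x < n -> f x < k) ->
  (forall x, x < n -> f x != i) \/ (forall x, x < n -> f x != j) ->
  counits k ∘ (merge k i j ∘ wires k n f) = effect k n f.
Proof.
case: k => // k ik jk ij fk fij.
have bumpf l : l <= k -> (forall x, x < n -> f x != l) ->
    exists2 g, (forall x, x < n -> g x < k) & wires k.+1 n f = pad k l ∘ wires k n g.
  move=> lk fl; exists (unbump l \o f) => [x xn|].
    by have := fl x xn; have := fk x xn; rewrite /unbump /=; lia.
  rewrite pad_wires // => [|x xn].
    apply: wires_ext => x xn; have := fl x xn; have := fk x xn.
    by rewrite /bump /unbump /=; lia.
  by have := fl x xn; have := fk x xn; rewrite /unbump /=; lia.
rewrite /effect; case: fij => /bumpf[//|g gk ->].
  have [j' jk' ->] : exists2 j', j' < k & j = bump i j'.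
    by apply: bump_split; rewrite // eq_sym.
  by rewrite (reassoc2 (counits_merge_padr _ _)) //
    pcompA counits_pad.
have [i' ik' ->] : exists2 i', i' < k & i = bump j i' by apply: bump_split.
by rewrite (reassoc2 (counits_merge_pad _ _)) //
    pcompA counits_pad.
Qed.

(** Both sides are unchanged by merging [i] and [j], as each of them leaves one
of these parts empty, and merging makes them equal. *)
Lemma effect_rename k i j n f g : i < k -> j < k -> i != j ->
  (forall x, x < n -> f x < k) -> (forall x, x < n -> f x != j) ->
  (forall x, x < n -> g x = if f x == i then j else f x) ->
  effect k n f = effect k n g.
Proof.
move=> ik jk ij fk fj gE.
have gk x : x < n -> g x < k by move=> xn; rewrite gE //; case: ifP => // _; exact: fk.
rewrite -(effect_merge ik jk ij fk (or_intror fj)).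
rewrite -(effect_merge ik jk ij gk) => [|]; last first.
  by left=> x xn; rewrite gE //; case: ifPn => // _; rewrite eq_sym.
rewrite (merge_wires ik jk gk) // => x xn; rewrite gE //.
by case: ifPn => _; rewrite eqxx ?orbT.
Qed.

(** * Effects depend only on the kernel *)

Lemma effect_addl a k n f : (forall x, x < n -> f x < k) ->
  effect (a + k) n (addn a \o f) = effect k n f.
Proof.
move=> fk; elim: a => [|a IHa]; first by congr (_ ∘ _); apply: wires_ext.
rewrite -IHa -(effect_pad (j := 0) (k := a + k)) // => x xn /=.
by rewrite ltn_add2l fk.
Qed.

Lemma effect_addr a k n f : (forall x, x < n -> f x < k) ->
  effect (a + k) n f = effect k n f.
Proof.
move=> fk; elim: a => [//|a IHa].
have fak x : x < n -> f x < a + k by move=> /fk; lia.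
rewrite -IHa -(effect_pad (leqnn (a + k)) fak) /effect.
congr (_ ∘ _); apply: wires_ext => x /fak; rewrite /bump /=; lia.
Qed.

(** The values of [f] are renamed to those of [g] one at a time; as the two
ranges are disjoint, each new name is unused when it is introduced. *)
Lemma effect_disjoint k n f g :
  (forall x, x < n -> f x < k) -> (forall x, x < n -> g x < k) ->
  (forall x y, x < n -> y < n -> (f x == f y) = (g x == g y)) ->
  (forall x y, x < n -> y < n -> f x != g y) ->
  effect k n f = effect k n g.
Proof.
move=> fk gk fg dfg.
(* [h v] has the classes of the inputs below [v] renamed. *)
pose old v x := has (fun y => f y == f x) (seq.iota 0 v).
pose h v x := if old v x then g x else f x.
have hk v x : x < n -> h v x < k by rewrite /h; case: ifP; auto.
have step v : v <= n -> effect k n f = effect k n (h v).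
  elim: v => [//|v IHv] vn; rewrite IHv ?(ltnW vn) //.
  have oldS x : old v.+1 x = old v x || (f v == f x).
    by rewrite /old -addn1 iotaD has_cat /= orbF.
  have [ov|nov] := boolP (old v v).
    congr (_ ∘ _); apply: wires_ext => x xn; rewrite /h oldS.
    case: eqP => [fvx|_]; last by rewrite orbF.
    by rewrite (_ : old v x) // /old -fvx.
  apply: (effect_rename (i := f v) (j := g v)); auto.
    move=> x xn; rewrite /h; case: ifPn => ox; last exact: dfg.
    rewrite -fg //; apply: contra nov => /eqP fxv.
    by rewrite /old -fxv.
  move=> x xn; rewrite /h oldS; case: (boolP (old v x)) => [ox|nox] /=.
    by rewrite eq_sym (negbTE (dfg v x _ _)).
  rewrite eq_sym; case: eqP => // fvx; apply/eqP; rewrite -fg // fvx eqxx //.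
rewrite (step n) // ; congr (_ ∘ _); apply: wires_ext => x xn; rewrite /h.
case: ifPn => // /hasP[]; exists x => //; by rewrite mem_iota.
Qed.

(** Adding empty parts makes the ranges of [f] and [g] disjoint. *)
Lemma eq_ker_effect k k' n f g :
  (forall x, x < n -> f x < k) -> (forall x, x < n -> g x < k') ->
  (forall x y, x < n -> y < n -> (f x == f y) = (g x == g y)) ->
  effect k n f = effect k' n g.
Proof.
move=> fk gk fg.
rewrite -(effect_addl k' fk) -(effect_addr k gk) addnC.
apply: effect_disjoint => [x /fk|x /gk|x y xn yn|x y xn yn] /=; try lia.
  by rewrite eqn_add2l fg.
by have := gk y yn; lia.
Qed.

(** * Precomposition of effects *)

(** What remains on the parts when a generator is moved through [wires]: a
morphism that commutes with joining a wire, after renaming of parts, and which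
can be reabsorbed in a normal form once the parts are discarded. *)
Definition apex_map k' k (X : P k' k) : Prop :=
  (forall i, i < k ->
     exists2 i', i' < k' & X ∘ join k' i' = join k i ∘ up X) /\
  (forall n g, (forall x, x < n -> g x < k') ->
     exists k'' g', (forall x, x < n -> g' x < k'') /\
       counits k ∘ (X ∘ wires k' n g) = effect k'' n g').

Lemma apex_map_id k : apex_map (pid k : P k k).
Proof.
split=> [i ik|n g gk]; first by exists i; rewrite // up_id pcompl pcompr.
by exists k, g; rewrite pcompl.
Qed.

(** If [i = j] the special law makes the merge trivial; if not, the inputs
of [j] are first moved to [i]. *)
Lemma apex_map_merge k i j : i < k -> j < k -> apex_map (merge k i j).
Proof.
move=> ik jk; split=> [l lk|n g gk]; first by exists l; rewrite // merge_join.
have [<-|ij] := eqVneq i j.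
  exists k, g; split=> //; rewrite /merge (reassoc (esym (join_mu ik))).
  by rewrite (reassocK (muW_deltaW _)) join_iota // pcompl.
pose g' x := if g x == j then i else g x.
have g'k x : x < n -> g' x < k by rewrite /g'; case: ifP; auto.
exists k, g'; split=> //.
rewrite (merge_wires ik jk g'k) => [|x xn].
  apply: effect_merge => //; right=> x xn.
  by rewrite /g'; case: ifPn.
by rewrite /g'; case: ifP; rewrite !eqxx ?orbT.
Qed.

Lemma apex_map_eps k : apex_map (epsW k).
Proof.
split=> [i ik|n g gk].
  exists i.+1 => //.
  by rewrite joinS pcompA epsW_nat -pcompA epsW_swap.
by exists k.+1, g; rewrite pcompA.
Qed.

(** A generator that meets [wires] moves to the side of the parts.  This
property, unlike [absorbed], concerns [wires] before discarding, and so it can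
be carried through idle wires on the left. *)
Definition routable m n (h : P m n) : Prop :=
  forall k f, (forall x, x < n -> f x < k) -> exists k' f' (X : P k' k),
  [/\ forall x, x < m -> f' x < k', apex_map X
    & wires k n f ∘ h = X ∘ wires k' m f'].

Definition fcons a (f : nat -> nat) x := if x is x.+1 then f x else a.

Lemma routable_up m n (h : P m n) : routable h -> routable (up h).
Proof.
move=> hh k f fk.
have [x xn|k' [f' [X [f'k [Xj Xe] e]]]] := hh k (f \o S); first exact: fk.
have [i' ik' jX] := Xj (f 0) (fk 0 isT).
exists k', (fcons i' f'), X; split=> // [[|x] xm|]; [by []|exact: f'k|].
by rewrite /= -pcompA -up_comp e up_comp pcompA -jX pcompA.
Qed.

Lemma routable_tens a m n (h : P m n) : routable h -> routable (pid a ⊗ h).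
Proof.
move=> hh; elim: a => [|a IHa]; first by rewrite ptens0l.
by rewrite tensS; apply: routable_up.
Qed.

Lemma routable_same m n (h : P m n) :
  (forall k f, (forall x, x < n -> f x < k) ->
    exists2 f', (forall x, x < m -> f' x < k) & wires k n f ∘ h = wires k m f') ->
  routable h.
Proof.
move=> hh k f /hh[f' f'k e]; exists k, f', (pid k).
by rewrite pcompl; split=> //; apply: apex_map_id.
Qed.

Lemma routable_id n : routable (pid n : P n n).
Proof. by apply: routable_same => k f fk; exists f; rewrite ?pcompr. Qed.

Lemma routable_mu b : routable (muW b).
Proof.
apply: routable_same => k f fk; exists (fcons (f 0) f) => [[|x] xb|].
- exact: fk.
- exact: fk.
by rewrite /= -pcompA -muW_nat !pcompA join_mu ?fk // up_comp pcompA.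
Qed.

Lemma routable_iota b : routable (iotaW b).
Proof.
apply: routable_same => k f fk; exists (f \o S) => [x xb|]; first exact: fk.
by rewrite /= -pcompA -iotaW_nat (reassocK (join_iota _)) // fk.
Qed.

Lemma routable_swap b : routable (swapW b).
Proof.
apply: routable_same => k f fk.
exists (fcons (f 1) (fcons (f 0) (f \o S \o S))) => [[|[|x]] xb|]; try exact: fk.
rewrite /= !up_comp -!pcompA -swap_nat (reassoc (join_comm (fk 0 isT) (fk 1 isT))).
by rewrite -!pcompA (reassocK (swapK _ _)).
Qed.

Lemma routable_delta b : routable (deltaW b).
Proof.
move=> k f fk.
exists k, (fcons (f 0) (f \o S \o S)), (merge k (f 0) (f 1)).
split=> [[|x] xb||]; try exact: fk.
  by apply: apex_map_merge; apply: fk.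
rewrite /= pcompA merge_joinl ?fk // up_comp -!pcompA.
by rewrite deltaW_nat.
Qed.

(** A counit on an input is a new part with this input alone, discarded at
once. *)
Lemma routable_eps b : routable (epsW b).
Proof.
move=> k f fk; exists k.+1, (fcons 0 (bump 0 \o f)), (epsW k).
split=> [[|x] xb||]; [by []|exact: fk|exact: apex_map_eps|].
have e : wires k.+1 b (bump 0 \o f) = iotaW k ∘ wires k b f.
  by rewrite -pad_wires //; case: (k).
rewrite -epsW_nat; congr (_ ∘ _).
change (up (wires k b f) = muW k ∘ up (wires k.+1 b (bump 0 \o f))).
by rewrite e up_comp pcompA muW_unitr pcompl.
Qed.

(** Idle wires on the left are built in because an effect on [n] wires says
nothing about [h] used beside other wires.  Unlike [routable], this is closed
under composition: only one [apex_map] at a time meets the counits. *)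
Definition absorbed m n (h : P m n) : Prop :=
  forall a k f, (forall x, x < a + n -> f x < k) -> exists k' f',
    (forall x, x < a + m -> f' x < k') /\
    effect k (a + n) f ∘ (pid a ⊗ h) = effect k' (a + m) f'.

Lemma routable_absorbed m n (h : P m n) : routable h -> absorbed h.
Proof.
move=> hh a k f fk.
have [k' [f' [X [f'k [_ Xe] e]]]] := @routable_tens a _ _ _ hh _ _ fk.
have [k'' [g [gk eg]]] := Xe _ _ f'k.
by exists k'', g; split; rewrite // -eg -e /effect -pcompA.
Qed.

Lemma absorbed_comp m n p (g : P n p) (h : P m n) :
  absorbed g -> absorbed h -> absorbed (g ∘ h).
Proof.
move=> gg hh a k f fk.
have [k' [f' [f'k e]]] := gg a k f fk.
have [k'' [f'' [f''k e']]] := hh a k' f' f'k.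
exists k'', f''; split=> //.
by rewrite -{1}(pcompl (pid a)) ptens_comp pcompA e e'.
Qed.

Lemma absorbed_cast m m' n n' (em : m = m') (en : n = n') (h : P m n) :
  absorbed h -> absorbed (cast_hom em en h).
Proof. by case: m' / em; case: n' / en. Qed.

Lemma absorbed_tens b m n (h : P m n) : absorbed h -> absorbed (pid b ⊗ h).
Proof.
move=> hh a.
have -> : pid a ⊗ (pid b ⊗ h) =
    cast_hom (esym (addnA a b m)) (esym (addnA a b n)) (pid (a + b) ⊗ h).
  rewrite -ptens_id ptensA; move: (pid a ⊗ (pid b ⊗ h)).
  by case: _ / (addnA a b m); case: _ / (addnA a b n).
move: (addnA a b m) (addnA a b n) (pid (a + b) ⊗ h) (hh (a + b)).
by move: (a + b + m) (a + b + n) => p q e1 e2; case: p / e1; case: q / e2.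
Qed.

Lemma absorbed_effect m (h : P m 0) : absorbed h ->
  exists k f, (forall x, x < m -> f x < k) /\ h = effect k m f.
Proof.
move=> /(_ 0 0 id)[//|k [f [fk e]]]; exists k, f; split=> //.
by rewrite -e ptens0l /effect /= !pcompl.
Qed.

End Spiders.

(** * Braidings from the elementary crossing *)

Section Braids.
Variable P : prop.

Lemma pbraid0S n : pbraid 0 n.+1 = up (pbraid 0 n) :> P n.+1 (n + 0).+1.
Proof.
apply: (etrans (esym (cast_hom_id _ _ _)) (etrans (@pbraid_hex P 0 1 n) _)).
rewrite cast_hom_id pbraid01.
by apply: (etrans (congr1 _ (ptens_id P 1 n))); apply: pcompr.
Qed.

Lemma pbraid1S n :
  pbraid 1 n.+1 = up (pbraid 1 n) ∘ (pbraid 1 1 ⊗ pid n) :> P n.+2 (n + 1).+1.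
Proof.
apply: (etrans (esym (cast_hom_id _ _ _)) (etrans (@pbraid_hex P 1 1 n) _)).
by rewrite cast_hom_id.
Qed.

(** The hexagon splits the braiding of [n] past [1 + m], and this is the
inverse of that decomposition. *)
Lemma pbraidS m n : pbraid m.+1 n =
  cast_hom (erefl (m + n).+1) (esym (addnA n 1 m))
    (((pbraid 1 n ⊗ pid m : P (n + m).+1 (n + 1 + m)) ∘ up (pbraid m n)))
  :> P (m + n).+1 (n + m.+1).
Proof.
set y := (_ ∘ _).
have hex := @pbraid_hex P n 1 m.
set x := cast_hom _ _ (pbraid n (1 + m)) in hex.
have xy : (x : P (n + 1 + m) (m + n).+1) ∘ y = pid (m + n).+1.
  rewrite hex cast_hom_id /y -pcompA.
  have k : (pbraid n 1 ⊗ pid m : P (n + 1 + m) (n + m).+1) ∘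
      (pbraid 1 n ⊗ pid m : P (n + m).+1 (n + 1 + m)) = pid (n + m).+1.
    apply: (etrans (esym (whisk_comp m (pbraid n 1) (pbraid 1 n)))).
    by rewrite pbraidK; exact: (ptens_id P n.+1 m).
  by rewrite (reassocK k) -up_comp pbraidK up_id.
have zx : (cast_hom (erefl _) (addnA n 1 m) (pbraid m.+1 n)) ∘ x = pid (n + 1 + m).
  rewrite /x; move: (addnA 1 m n) => e.
  rewrite (eq_irrelevance (esym e) (erefl (m + n).+1)).
  move: (addnA n 1 m) => e'; move: (n + 1 + m) e' => q e'; case: q / e' => /=.
  exact: (pbraidK P n m.+1).
have zE : cast_hom (erefl _) (addnA n 1 m) (pbraid m.+1 n) = y.
  by rewrite -[RHS]pcompl -zx -pcompA xy pcompr.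
rewrite -zE; move: (addnA n 1 m) => e'; move: (n + 1 + m) e' => q e'.
by case: q / e'.
Qed.

End Braids.

(** * Every effect has a normal form *)

Section Terms.
Variables (P : prop) (mu : P 2 1) (iota : P 0 1) (delta : P 1 2)
  (epsilon : P 1 0).
Hypothesis law : forall m n (e : frob_eqn m n),
  (frob_sides mu iota delta epsilon e).1 = (frob_sides mu iota delta epsilon e).2.

Local Notation absorbed := (absorbed mu iota epsilon).

(** With idle wires on both sides the property passes to tensor products. *)
Definition stable m n (h : P m n) := forall b, absorbed (h ⊗ pid b).

Lemma routable_stable m n (h : P m n) :
  (forall b, routable mu iota epsilon (h ⊗ pid b)) -> stable h.
Proof. by move=> hh b; apply: routable_absorbed (hh b). Qed.

Lemma stable_id n : stable (pid n : P n n).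
Proof. by move=> b; rewrite ptens_id; apply/routable_absorbed/routable_id. Qed.

Lemma stable_comp m n p (g : P n p) (h : P m n) :
  stable g -> stable h -> stable (g ∘ h).
Proof. by move=> gg hh b; rewrite whisk_comp; apply: absorbed_comp. Qed.

Lemma stable_cast m m' n n' (em : m = m') (en : n = n') (h : P m n) :
  stable h -> stable (cast_hom em en h).
Proof. by case: m' / em; case: n' / en. Qed.

Lemma stable_tens m n m' n' (g : P m n) (h : P m' n') :
  stable g -> stable h -> stable (g ⊗ h).
Proof.
move=> gg hh b; rewrite ptensA tens_split_comp; apply: absorbed_cast.
by apply: absorbed_comp; [apply: gg | apply/absorbed_tens/hh].
Qed.

Lemma stable_up m n (h : P m n) : stable h -> stable (up h).
Proof. by move=> hh; apply: (stable_tens (@stable_id 1)). Qed.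

Lemma stable_braid m n : stable (pbraid m n : P (m + n) (n + m)).
Proof.
have b0 k : stable (pbraid 0 k : P (0 + k) (k + 0)).
  elim: k => [|k IHk]; first by rewrite pbraid00; apply: stable_id.
  by rewrite pbraid0S; apply: stable_up.
have b11 : stable (pbraid 1 1 : P 2 2).
  by apply: routable_stable => b; apply: routable_swap.
have b1 k : stable (pbraid 1 k : P (1 + k) (k + 1)).
  elim: k => [|k IHk]; first by rewrite pbraid10; apply: stable_id.
  rewrite pbraid1S; apply: stable_comp; first exact: stable_up.
  exact: (stable_tens b11 (@stable_id k)).
elim: m => // m IHm; rewrite pbraidS; apply: stable_cast; apply: stable_comp.
  exact: (stable_tens (b1 n) (@stable_id m)).
exact: stable_up.
Qed.

Lemma stable_term (h : forall m n, frob_gen m n -> P m n) :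
  h _ _ g_mul = mu -> h _ _ g_unit = iota -> h _ _ g_comul = delta ->
  h _ _ g_counit = epsilon ->
  forall m n (t : term frob_gen m n), stable (term_eval h t).
Proof.
move=> hm hi hd he m n; elim=> {m n} /=.
- move=> m n [] ; rewrite ?(hm, hi, hd, he); apply: routable_stable => b.
  + exact: (routable_mu law).
  + exact: (routable_iota law).
  + exact: (routable_delta law).
  + exact: (routable_eps law).
- by move=> n; apply: stable_id.
- by move=> m n p u uu v vv; apply: stable_comp.
- by move=> m n m' n' u uu v vv; apply: stable_tens.
- by move=> m n; apply: stable_braid.
Qed.

Lemma stable_effect m (h : P m 0) : stable h ->
  exists k f, (forall x, x < m -> f x < k) /\ h = effect mu iota epsilon k m f.
Proof.
move=> /(_ 0) hh; apply: absorbed_effect; rewrite -(tens0r h).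
exact: absorbed_cast.
Qed.

End Terms.

(** * Props of relations between colourings *)

(** [R] represents a prop [Q] faithfully by relations between boolean
colourings of inputs and outputs, a wire being given by its position.  The
prop is kept abstract so that evaluating a colouring never unfolds the
composition of corelations. *)
Section Relational.
Variables (Q : prop)
  (R : forall m n, Q m n -> (nat -> bool) -> (nat -> bool) -> Prop).
Hypothesis R_ext : forall m n (c d : Q m n),
  (forall f g, R c f g <-> R d f g) -> c = d.
Hypothesis R_comp : forall m n p (d : Q n p) (c : Q m n) f h,
  R (d ∘ c) f h <-> exists g, R c f g /\ R d g h.
Hypothesis R_tens : forall m n m' n' (c : Q m n) (c' : Q m' n') f g,
  R (c ⊗ c') f g <-> R c f g /\ R c' (f \o addn m) (g \o addn n).
Hypothesis R_id : forall n f g,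
  R (pid n) f g <-> forall i, i < n -> g i = f i.
Hypothesis R_swap : forall f g,
  R (pbraid 1 1 : Q 2 2) f g <-> g 0 = f 1 /\ g 1 = f 0.

Variables (mu : Q 2 1) (eta : Q 0 1) (delta : Q 1 2) (eps : Q 1 0).
Hypothesis R_mu : forall f g, R mu f g <-> f 0 = g 0 /\ f 1 = g 0.
Hypothesis R_eta : forall f g, R eta f g <-> True.
Hypothesis R_delta : forall f g, R delta f g <-> g 0 = f 0 /\ g 1 = f 0.
Hypothesis R_eps : forall f g, R eps f g <-> True.

Lemma R_id0 f g : R (pid 0) f g <-> True.
Proof. by rewrite R_id. Qed.

Lemma R_id1 f g : R (pid 1) f g <-> g 0 = f 0.
Proof. by rewrite R_id; split=> [/(_ 0)->//|? [|]]. Qed.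

Let RE := (R_mu, R_delta, R_eta, R_eps, R_id0, R_id1, R_swap).
Let RtE := (@R_tens 2 1 1 1, @R_tens 1 1 2 1, @R_tens 0 1 1 1,
  @R_tens 1 1 0 1, @R_tens 1 2 1 1, @R_tens 1 1 1 2,
  @R_tens 1 0 1 1, @R_tens 1 1 1 0).

(** In every law but the extra one all the wires are connected, so that a
middle colouring is constant; in the extra law any colouring serves. *)
Lemma relational_law m n (e : frob_eqn m n) :
  (frob_sides mu eta delta eps e).1 = (frob_sides mu eta delta eps e).2.
Proof.
case: e => /=; apply: R_ext => f g; split.
all: try (move=> /R_comp[h []]); rewrite ?RtE ?RE /comp /= => *.
all: try (apply/R_comp; exists (fun=> g 0)); rewrite ?RtE ?RE /comp /=.
all: repeat match goal with H : _ /\ _ |- _ => destruct H end.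
(* [congruence] is syntactic, so the shifted positions are computed first. *)
all: change (1 + 1) with 2 in *; change (1 + 0) with 1 in *.
all: change (2 + 0) with 2 in *; change (0 + 0) with 0 in *.
all: by repeat split; congruence.
Qed.

Lemma R_up m n (c : Q m n) f g :
  R (up c) f g <-> g 0 = f 0 /\ R c (f \o S) (g \o S).
Proof. by rewrite -R_id1; exact: (R_tens (pid 1) c). Qed.

Lemma R_whisk b m n (c : Q m n) f g : R (c ⊗ pid b) f g <->
  R c f g /\ forall i, i < b -> g (n + i) = f (m + i).
Proof. by rewrite R_tens R_id. Qed.

Lemma R_muW b f g : R (muW mu b) f g <->
  (f 0 = g 0 /\ f 1 = g 0) /\ forall i, i < b -> g i.+1 = f i.+2.
Proof. by rewrite -R_mu; exact: (R_whisk b mu). Qed.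

Lemma R_etaW b f g :
  R (iotaW eta b) f g <-> forall i, i < b -> g i.+1 = f i.
Proof.
apply: (iff_trans (R_whisk b eta f g)); rewrite R_eta.
by split=> [[]|].
Qed.

Lemma R_epsW b f g :
  R (epsW eps b) f g <-> forall i, i < b -> g i = f i.+1.
Proof.
apply: (iff_trans (R_whisk b eps f g)); rewrite R_eps.
by split=> [[]|].
Qed.

Lemma R_swapW b f g : R (swapW Q b) f g <->
  (g 0 = f 1 /\ g 1 = f 0) /\ forall i, i < b -> g i.+2 = f i.+2.
Proof. by rewrite -R_swap; exact: (R_whisk b (pbraid 1 1)). Qed.

Lemma R_join k i f g : i < k ->
  R (join mu eps k i) f g <-> g i = f 0 /\ forall x, x < k -> g x = f x.+1.
Proof.
elim: k i f g => [//|k IHk] [|i] f g ik.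
  rewrite R_muW; split=> [[[f0 f1] fx]|[f0 fx]].
    by split=> // [[|x]] xk //; apply: fx.
  by rewrite -f0 -fx //; split=> // x xk; apply: (fx x.+1).
rewrite R_comp; split.
  move=> [h []]; rewrite R_swapW => -[[h0 h1] hx].
  rewrite R_up IHk // => -[g0 [gi gx]]; split; first by rewrite -h1; exact: gi.
  move=> [|x] xk; first by rewrite g0 h0.
  by rewrite [LHS]gx // [LHS]hx.
move=> [gi gx]; exists (fun x =>
  if x is x'.+1 then if x' is x''.+1 then f x else f 0 else f 1).
rewrite R_swapW; split=> //.
rewrite R_up IHk // gx //; split=> //; split=> // x xk.
by rewrite /= gx.
Qed.

Lemma R_wires k n f u v : (forall x, x < n -> f x < k) ->
  R (wires mu eta eps k n f) u v <-> forall x, x < n -> u x = v (f x).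
Proof.
elim: n f u v => [|n IHn] f u v fk.
  split=> // _; elim: k {fk} => [|k IHk] in v *; first by rewrite R_id0.
  apply/R_comp; exists (v \o S); split; first exact: IHk.
  exact/R_etaW.
rewrite R_comp; split.
  move=> [h []]; rewrite R_up IHn => [|x xn]; last exact: fk.
  move=> [h0 hx]; rewrite R_join ?fk // => -[vf vx].
  by move=> [|x] xn; [rewrite vf | rewrite vx ?fk //; apply: hx].
move=> uv; exists (fun x => if x is x'.+1 then v x' else u 0).
rewrite R_up IHn => [|x xn]; last exact: fk.
by rewrite R_join ?fk // -uv //; split=> //; split=> // x xn; apply: uv.
Qed.

Lemma R_counits k u v : R (counits (P := Q) eps k) u v <-> True.
Proof.
split=> // _; elim: k u => [|k IHk] u; first by rewrite R_id0.
apply/R_comp; exists (u \o S); split=> //.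
exact/R_epsW.
Qed.

Lemma R_effect k n f u v : (forall x, x < n -> f x < k) ->
  R (effect mu eta eps k n f) u v <->
  exists w, forall x, x < n -> u x = w (f x).
Proof.
move=> fk; rewrite R_comp; split=> [[w []]|[w uw]].
  by rewrite R_wires // => uw _; exists w.
by exists w; rewrite R_wires // R_counits.
Qed.

(** The class of [x] under one kernel is a colouring compatible with it, hence
with the other kernel too. *)
Lemma effect_eq_ker k k' n f g :
  (forall x, x < n -> f x < k) -> (forall x, x < n -> g x < k') ->
  effect mu eta eps k n f = effect mu eta eps k' n g ->
  forall x y, x < n -> y < n -> (f x == f y) = (g x == g y).
Proof.
move=> fk gk e x y xn yn.
have main k1 k2 f1 f2 : (forall x, x < n -> f1 x < k1) ->
    (forall x, x < n -> f2 x < k2) ->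
    effect mu eta eps k1 n f1 = effect mu eta eps k2 n f2 ->
    f1 x = f1 y -> f2 x = f2 y.
  move=> f1k f2k e12 f1xy.
  pose u z := f2 z == f2 x.
  have : R (effect mu eta eps k2 n f2) u u.
    by apply/R_effect => //; exists (fun z => z == f2 x).
  rewrite -e12 R_effect // => -[w uw].
  by apply/esym/eqP; rewrite -/(u y) uw // -f1xy -uw // /u.
by apply/eqP/eqP; [apply: main e | apply: main (esym e)].
Qed.

End Relational.

(** * Corelations and their colourings *)

Definition colN m n (c : FinCorel m n) (f g : nat -> bool) : Prop :=
  @col m n c (f \o @nat_of_ord m) (g \o @nat_of_ord n).

Definition extend_colouring n (f : 'I_n -> bool) (i : nat) : bool :=
  if insub i is Some j then f j else false.

Lemma extend_colouringK n (f : 'I_n -> bool) :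
  extend_colouring f \o @nat_of_ord n = f.
Proof. by apply: funext => i; rewrite /= /extend_colouring valK. Qed.

Lemma colN_extend m n (c : FinCorel m n) f g :
  col c f g <-> colN c (extend_colouring f) (extend_colouring g).
Proof. by rewrite /colN !extend_colouringK. Qed.

Lemma colN_ext m n (c d : FinCorel m n) :
  (forall f g, colN c f g <-> colN d f g) -> c = d.
Proof.
by move=> cd; apply: col_ext => f g; rewrite !colN_extend; apply: cd.
Qed.

Lemma colN_comp m n p (d : FinCorel n p) (c : FinCorel m n) f h :
  colN (d ∘ c) f h <-> exists g, colN c f g /\ colN d g h.
Proof.
split=> [/col_comp[g [cg dg]]|[g [cg dg]]]; last first.
  by apply/col_comp; exists (g \o @nat_of_ord n).
by exists (extend_colouring g); rewrite /colN extend_colouringK.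
Qed.

Lemma colN_tens m n m' n' (c : FinCorel m n) (c' : FinCorel m' n') f g :
  colN (c ⊗ c') f g <-> colN c f g /\ colN c' (f \o addn m) (g \o addn n).
Proof. exact: col_tens. Qed.

Lemma colN_id n f g :
  colN (pid n : FinCorel n n) f g <-> forall i, i < n -> g i = f i.
Proof.
split=> [/col_id gf i ik|gf].
  exact: (congr1 (@^~ (Ordinal ik)) gf).
by apply/col_id/funext => i; apply: gf.
Qed.

Lemma colN_swap f g :
  colN (pbraid 1 1 : FinCorel 2 2) f g <-> g 0 = f 1 /\ g 1 = f 0.
Proof.
rewrite /colN; split=> [H|[g0 g1]].
  have [gl gr] := (@col_braid_split 1 1 _ _).1 H.
  by split; [exact: (congr1 (@^~ ord0) gl) | exact: (congr1 (@^~ ord0) gr)].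
by apply/(@col_braid_split 1 1); split; apply: funext => i; rewrite ord1.
Qed.

Lemma total_equiv (T : Type) : equivalence_rel (fun _ _ : T => true).
Proof. by []. Qed.

Definition onePart m n : FinCorel m n :=
  corel_of_equiv (@total_equiv ('I_m + 'I_n)).

Lemma colN_onePart m n f g : colN (onePart m n) f g <->
  exists b, (forall i, i < m -> f i = b) /\ (forall i, i < n -> g i = b).
Proof.
split=> [H|[b [fb gb]] x y _]; last first.
  have E z : cospan_map (f \o @nat_of_ord m) (g \o @nat_of_ord n) z = b.
    by case: z => i /=; auto.
  by rewrite !E.
have E x y := H x y (same_part_of_equiv _ _ _).
have [m0|m0] := posnP m; last first.
  exists (f 0); split=> i ik.
    exact: (E (inl (Ordinal ik)) (inl (Ordinal m0))).
  exact: (E (inr (Ordinal ik)) (inl (Ordinal m0))).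
have [n0|n0] := posnP n; first by exists true; rewrite m0 n0.
exists (g 0); split=> i ik; first by rewrite m0 in ik.
exact: (E (inr (Ordinal ik)) (inr (Ordinal n0))).
Qed.

Section OnePart.

Local Notation mu := (onePart 2 1).
Local Notation eta := (onePart 0 1).
Local Notation delta := (onePart 1 2).
Local Notation eps := (onePart 1 0).

Lemma colN_mu f g : colN mu f g <-> f 0 = g 0 /\ f 1 = g 0.
Proof.
rewrite colN_onePart; split=> [[b [fb gb]]|[f0 f1]]; first by rewrite !fb // gb.
by exists (g 0); split=> [[|[|]]|[|]].
Qed.

Lemma colN_delta f g : colN delta f g <-> g 0 = f 0 /\ g 1 = f 0.
Proof.
rewrite colN_onePart; split=> [[b [fb gb]]|[f0 f1]]; first by rewrite !gb // fb.
by exists (f 0); split=> [[|]|[|[|]]].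
Qed.

Lemma colN_eta f g : colN eta f g <-> True.
Proof.
by rewrite colN_onePart; split=> // _; exists (g 0); split=> [[|]|[|]].
Qed.

Lemma colN_eps f g : colN eps f g <-> True.
Proof.
by rewrite colN_onePart; split=> // _; exists (f 0); split=> [[|]|[|]].
Qed.

Lemma onePart_law m n (e : frob_eqn m n) :
  (frob_sides (P := FinCorel) mu eta delta eps e).1 =
  (frob_sides (P := FinCorel) mu eta delta eps e).2.
Proof.
exact: (relational_law colN_ext colN_comp colN_tens colN_id colN_swap
          colN_mu colN_eta colN_delta colN_eps).
Qed.

Lemma colN_effect k n f u v : (forall x, x < n -> f x < k) ->
  colN (effect mu eta eps k n f) u v <->
  exists w, forall x, x < n -> u x = w (f x).
Proof.
exact: (R_effect colN_comp colN_tens colN_id colN_swap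
          colN_mu colN_eta colN_eps).
Qed.

Lemma onePart_effect_eq_ker k k' n f g :
  (forall x, x < n -> f x < k) -> (forall x, x < n -> g x < k') ->
  effect mu eta eps k n f = effect mu eta eps k' n g ->
  forall x y, x < n -> y < n -> (f x == f y) = (g x == g y).
Proof.
exact: (effect_eq_ker colN_comp colN_tens colN_id colN_swap
          colN_mu colN_eta colN_eps).
Qed.

(** Each input is mapped to a chosen element of its part. *)
Lemma onePart_effect_surj n (c : FinCorel n 0) :
  exists k f, (forall x, x < n -> f x < k) /\ c = effect mu eta eps k n f.
Proof.
pose s (i j : 'I_n) := @same_part n 0 c (inl i) (inl j).
pose r (i : 'I_n) : 'I_n := odflt i [pick j | s i j].
have sr i : s i (r i).
  rewrite /r; case: pickP => //= /(_ i).
  by rewrite /s (same_part_equiv _ (inl i) (inl i) (inl i)).1.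
have rE i j : s i j -> r i = r j.
  move=> sij; rewrite /r (@eq_pick _ (s i) (s j)) => [|l]; last first.
    exact: (same_part_equiv _ _ _ _).2 sij.
  by case: pickP => //= /(_ (r j)); rewrite sr.
pose f x := if insub x is Some i then val (r i) else 0.
have fE (i : 'I_n) : f i = r i by rewrite /f valK.
have fn x : x < n -> f x < n by move=> xn; rewrite (fE (Ordinal xn)).
exists n, f; split=> //; apply: colN_ext => u v; rewrite colN_effect //.
split=> [H|[w uw]].
  exists u => x xn; rewrite (fE (Ordinal xn)).
  exact: (H (inl (Ordinal xn)) (inl _) (sr (Ordinal xn))).
move=> [i|[]//] [j|[]//] sij /=.
by rewrite !uw // !fE (rE _ _ sij).
Qed.

End OnePart.

(** With no points at all, the partition has no part; hence the
hypothesis. *)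
Lemma onePart_parts m n : 0 < m + n ->
  unique (fun c : corel m n => #|parts c| = 1) (onePart m n).
Proof.
move=> mn.
have x0 : 'I_m + 'I_n.
  by case: m n mn => [|m] [|n] // _; [right | left | left]; exact: ord0.
have partsE : parts (onePart m n : corel m n) = [set setT].
  apply/eqP; rewrite eqEsubset; apply/andP; split; apply/subsetP => A.
    move=> /imsetP[x _ ->]; rewrite inE; apply/eqP/setP => y.
    by rewrite !inE.
  rewrite inE => /eqP->; apply/imsetP; exists x0; rewrite ?inE //.
  by apply/setP => y; rewrite !inE.
split=> [|d /eqP/cards1P[A dA]]; first by rewrite partsE cards1.
apply: val_inj; apply: (etrans partsE); rewrite [RHS]dA; congr [set _].
by rewrite -(cover_partition (partsP d)) dA cover1.
Qed.

(** * Bending wires *)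

Section Bending.
Variables (P : prop) (mu : P 2 1) (iota : P 0 1) (delta : P 1 2)
  (epsilon : P 1 0).

Definition bend m n (x : P m n.+1) : P m.+1 n :=
  epsW epsilon n ∘ (muW mu n ∘ up x).

Definition unbend m n (y : P m.+1 n) : P m n.+1 :=
  up y ∘ (deltaW delta m ∘ iotaW iota m).

Hypothesis law : forall m n (e : frob_eqn m n),
  (frob_sides mu iota delta epsilon e).1 = (frob_sides mu iota delta epsilon e).2.

Lemma bendK m n : cancel (@bend m n) (@unbend m n).
Proof.
move=> x; rewrite /unbend /bend !up_comp -!pcompA.
rewrite -(reassoc (deltaW_nat _ _)) -iotaW_nat (reassoc (frobW_l law _)).
by rewrite (reassocK (muW_unitl law _)) (reassocK (up_epsW_deltaW law _)).
Qed.

Lemma unbendK m n : cancel (@unbend m n) (@bend m n).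
Proof.
move=> y; rewrite /unbend /bend !up_comp.
rewrite (reassoc (muW_nat _ _)) (reassoc (frobW_r law _)) (muW_unitr law) pcompr.
by rewrite (reassoc (epsW_nat _ _)) (epsW_deltaW law) pcompr.
Qed.

End Bending.

(** * Morphisms of props *)

Section Transport.
Variables (P Q : prop) (phi : propMor P Q).
Variables (mu : P 2 1) (iota : P 0 1) (delta : P 1 2) (epsilon : P 1 0).

Lemma mor_up m n (f : P m n) : mor phi (up f) = up (mor phi f).
Proof. by rewrite /up -(mor_id phi); exact: (mor_tens phi (pid 1) f). Qed.

Lemma mor_whisk b m n (f : P m n) :
  mor phi (f ⊗ pid b) = mor phi f ⊗ pid b.
Proof. by rewrite mor_tens mor_id. Qed.

Lemma mor_swapW b : mor phi (swapW P b) = swapW Q b.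
Proof. by rewrite /swapW -(mor_braid phi 1 1); exact: (mor_whisk b (pbraid 1 1)). Qed.

Lemma mor_muW b : mor phi (muW mu b) = muW (mor phi mu) b.
Proof. exact: (mor_whisk b mu). Qed.

Lemma mor_iotaW b : mor phi (iotaW iota b) = iotaW (mor phi iota) b.
Proof. exact: (mor_whisk b iota). Qed.

Lemma mor_epsW b : mor phi (epsW epsilon b) = epsW (mor phi epsilon) b.
Proof. exact: (mor_whisk b epsilon). Qed.

Lemma mor_join k i :
  mor phi (join mu epsilon k i) = join (mor phi mu) (mor phi epsilon) k i.
Proof.
elim: k i => [|k IHk] [|i] /=; rewrite ?mor_epsW ?mor_muW //.
by rewrite mor_comp mor_up mor_swapW IHk.
Qed.

Lemma mor_wires k n f : mor phi (wires mu iota epsilon k n f) =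
  wires (mor phi mu) (mor phi iota) (mor phi epsilon) k n f.
Proof.
elim: n f => [|n IHn] f /=; last by rewrite mor_comp mor_join mor_up IHn.
by elim: k => [|k IHk] /=; rewrite ?mor_id // mor_comp mor_iotaW IHk.
Qed.

Lemma mor_effect k n f : mor phi (effect mu iota epsilon k n f) =
  effect (mor phi mu) (mor phi iota) (mor phi epsilon) k n f.
Proof.
rewrite /effect mor_comp mor_wires; congr (_ ∘ _).
by elim: k => [|k IHk] /=; rewrite ?mor_id // mor_comp mor_epsW IHk.
Qed.

Lemma mor_bend m n (x : P m n.+1) : mor phi (bend mu epsilon x) =
  bend (mor phi mu) (mor phi epsilon) (mor phi x).
Proof. by rewrite /bend !mor_comp mor_epsW mor_muW mor_up. Qed.

Lemma mor_frob_sides m n (e : frob_eqn m n) :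
  let s := frob_sides mu iota delta epsilon e in
  frob_sides (mor phi mu) (mor phi iota) (mor phi delta) (mor phi epsilon) e =
  (mor phi s.1, mor phi s.2).
Proof.
pose whiskE := (mor_whisk 1 mu, mor_whisk 1 iota, mor_whisk 1 delta,
  mor_whisk 1 epsilon, mor_tens phi (pid 1) mu, mor_tens phi (pid 1) iota,
  mor_tens phi (pid 1) delta, mor_tens phi (pid 1) epsilon).
by case: e => /=; rewrite ?mor_comp ?whiskE ?mor_id ?(mor_braid phi 1 1).
Qed.

Lemma bijective_mor_iso :
  (forall m n, injective (@mor P Q phi m n)) ->
  (forall m n (y : Q m n), exists x, y = mor phi x) ->
  isPropIso phi.
Proof.
move=> inj surj.
pose psi m n (y : Q m n) := projT1 (cid (surj m n y)).
have psiK m n (y : Q m n) : mor phi (psi m n y) = y.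
  by rewrite /psi; case: cid.
have psi_id n : psi n n (pid n) = pid n.
  by apply: inj; rewrite psiK mor_id.
have psi_comp m n p (g : Q n p) (f : Q m n) :
    psi _ _ (g ∘ f) = psi _ _ g ∘ psi _ _ f.
  by apply: inj; rewrite mor_comp !psiK.
have psi_tens m n m' n' (f : Q m n) (g : Q m' n') :
    psi _ _ (f ⊗ g) = psi _ _ f ⊗ psi _ _ g.
  by apply: inj; rewrite mor_tens !psiK.
have psi_braid m n : psi _ _ (pbraid m n) = pbraid m n.
  by apply: inj; rewrite mor_braid !psiK.
exists (PropMor psi_id psi_comp psi_tens psi_braid); split=> m n f //=.
by apply: inj; rewrite psiK.
Qed.

End Transport.

Lemma mor_term (S : signature) (P : propData) (rho : propMor (termData S) P)
    m n (t : termData S m n) :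
  mor rho t =
  term_eval (fun m n (s : S m n) => mor rho (t_gen s : termData S m n)) t.
Proof.
elim: t => {m n} //=.
- exact: (mor_id rho).
- by move=> m n p u <- v <-; exact: (mor_comp rho).
- by move=> m n m' n' u <- v <-; exact: (mor_tens rho).
- exact: (mor_braid rho).
Qed.

(** * The presented prop *)

Section FrobProp.

Let mu : FrobProp 2 1 := frobProp_gen g_mul.
Let iota : FrobProp 0 1 := frobProp_gen g_unit.
Let delta : FrobProp 1 2 := frobProp_gen g_comul.
Let epsilon : FrobProp 1 0 := frobProp_gen g_counit.

Let pi : propMor (freeProp frob_gen) FrobProp := coeq_mor _ _.

Lemma frobProp_law m n (e : frob_eqn m n) :
  (frob_sides mu iota delta epsilon e).1 = (frob_sides mu iota delta epsilon e).2.
Proof.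
have -> : frob_sides mu iota delta epsilon e =
    (mor pi (frob_lhs e), mor pi (frob_rhs e)).
  exact: (mor_frob_sides pi).
have := coeq_morE (free_lift frob_lhs) (free_lift frob_rhs) (free_gen e).
by rewrite !free_liftE.
Qed.

Lemma frobProp_term m n (x : FrobProp m n) :
  exists t : term frob_gen m n, x = term_eval frobProp_gen t.
Proof.
have [y ->] := quot_mor_surj x; have [t ->] := quot_mor_surj y.
exists t; exact: (mor_term (propMor_comp pi (quot_mor _)) t).
Qed.

Lemma frobProp_effect m (x : FrobProp m 0) :
  exists k f, (forall i, i < m -> f i < k) /\
    x = effect mu iota epsilon k m f.
Proof.
have [t ->] := frobProp_term x.
apply: stable_effect.
exact: (stable_term frobProp_law).
Qed.

End FrobProp.

Definition onePart_gen m n (s : frob_gen m n) : FinCorel m n := onePart m n.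

(** The two composites out of the free prop on the equations agree by its
universal property, since they agree on each equation. *)
Lemma frobProp_to_FinCorel : exists phi : propMor FrobProp FinCorel,
  forall m n (s : frob_gen m n), mor phi (frobProp_gen s) = onePart m n.
Proof.
pose chi := free_lift onePart_gen.
have chi_law m n (e : frob_eqn m n) :
    mor chi (frob_lhs e) = mor chi (frob_rhs e).
  have := mor_frob_sides chi (free_gen g_mul) (free_gen g_unit)
    (free_gen g_comul) (free_gen g_counit) e.
  rewrite !free_liftE => /= se; have := onePart_law e.
  by rewrite se.
have chi_lift m n (f : freeProp frob_eqn m n) :
    mor chi (mor (free_lift frob_lhs) f) = mor chi (mor (free_lift frob_rhs) f).
  pose side (s : forall m n, frob_eqn m n -> freeProp frob_gen m n) :=
    propMor_comp chi (free_lift s).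
  pose h m n (e : frob_eqn m n) : FinCorel m n := mor chi (frob_lhs e).
  have lhsE := @free_lift_uniq _ FinCorel h (side frob_lhs).
  have rhsE := @free_lift_uniq _ FinCorel h (side frob_rhs).
  rewrite [LHS]lhsE => [|p q e]; last first.
    exact: (congr1 (fun z => mor chi z) (free_liftE frob_lhs e)).
  rewrite [RHS]rhsE => // p q e; rewrite /h chi_law.
  exact: (congr1 (fun z => mor chi z) (free_liftE frob_rhs e)).
have [phi [phiE _]] := coeq_univ chi_lift.
by exists phi => m n s; rewrite [LHS]phiE free_liftE.
Qed.

(** Bending the outputs one by one reduces every hom-set to effects. *)
Lemma bijective_on_effects (P Q : prop) (phi : propMor P Q)
    (mu : P 2 1) (iota : P 0 1) (delta : P 1 2) (epsilon : P 1 0) :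
  (forall m n (e : frob_eqn m n),
    (frob_sides mu iota delta epsilon e).1 =
    (frob_sides mu iota delta epsilon e).2) ->
  (forall m, injective (@mor P Q phi m 0)) ->
  (forall m (y : Q m 0), exists x, y = mor phi x) ->
  isPropIso phi.
Proof.
move=> law inj0 surj0.
have lawQ m n (e : frob_eqn m n) :
    let s := frob_sides (mor phi mu) (mor phi iota) (mor phi delta)
      (mor phi epsilon) e in s.1 = s.2.
  by rewrite /= mor_frob_sides /= law.
apply: bijective_mor_iso => m n; elim: n m => // n IHn m.
  move=> x x' xx'; apply: (can_inj (@bendK _ _ _ _ _ law m n)).
  by apply: IHn; rewrite !mor_bend xx'.
move=> y; have [x yx] := IHn _ (bend (mor phi mu) (mor phi epsilon) y).
exists (unbend iota delta x); apply: (can_inj (@bendK _ _ _ _ _ lawQ m n)).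
by rewrite -mor_bend (unbendK law).
Qed.

Theorem theorem3p1p1 :
  exists phi : propMor FrobProp FinCorel,
    isPropIso phi /\
    [/\ unique (fun c : corel 2 1 => #|parts c| = 1)
               (mor phi (frobProp_gen g_mul)),
        unique (fun c : corel 0 1 => #|parts c| = 1)
               (mor phi (frobProp_gen g_unit)),
        unique (fun c : corel 1 2 => #|parts c| = 1)
               (mor phi (frobProp_gen g_comul)) &
        unique (fun c : corel 1 0 => #|parts c| = 1)
               (mor phi (frobProp_gen g_counit))].
Proof.
have [phi phiE] := frobProp_to_FinCorel.
exists phi; split; last by rewrite !phiE; split; apply: onePart_parts.
apply: (bijective_on_effects frobProp_law) => m.
  move=> x y; have [k [f [fk ->]]] := frobProp_effect x.
  have [l [g [gl ->]]] := frobProp_effect y.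
  rewrite !mor_effect !phiE => /(onePart_effect_eq_ker fk gl) fg.
  exact: (eq_ker_effect frobProp_law).
move=> y; have [k [f [fk ->]]] := onePart_effect_surj y.
exists (effect (frobProp_gen g_mul) (frobProp_gen g_unit) (frobProp_gen g_counit) k m f).
by rewrite mor_effect !phiE.
Qed.
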